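(* Let $m_*\in\mathbb N$. Assume there is $T_f\ge 0$ such that $f$ is continuous on $[T_f,\infty)$, and that $$f(t)\sim\sum_{k=1}^\infty p_k(\mathcal L_{m_*,n_k}(t))L_{m_*}(t)^{-\mu_k},$$ where $(\mu_k)_{k=1}^\infty$ is a divergent, strictly increasing sequence of positive numbers, the set $\mathcal S=\{\mu_k:k\in\mathbb N\}$ satisfies $x+y\in\mathcal S$ for all $x,y\in\mathcal S$, $(n_k)_{k=1}^\infty$ is a (not necessarily strictly) increasing sequence in $\mathbb N$, and $p_k\in\mathcal P(n_k,\mathbb R^n)$ for each $k$. Let $T_0\ge 0$ and let $y\in C^1((T_0,\infty),\mathbb R^n)$ be a solution of $y'=-Ay+G(y)+f(t)$ on $(T_0,\infty)$ with $y(t)\to 0$ as $t\to\infty$. Then $y(t)$ admits the asymptotic expansion $$y(t)\sim\sum_{k=1}^\infty q_k(\mathcal L_{m_*,n_k}(t))L_{m_*}(t)^{-\mu_k},$$ where $q_k\in\mathcal P(n_k,\mathbb R^n)$ for all $k\in\mathbb N$, and the $q_k$ are defined recursively by $q_1=A^{-1}p_1$ and, for $k\ge 2$, $$q_k=A^{-1}\Big(\sum_{m\ge 2}\ \sum_{\substack{j_1,j_2,\ldots,j_m\ge 1\\ \mu_{j_1}+\mu_{j_2}+\cdots+\mu_{j_m}=\mu_k}}\mathcal G_m(q_{j_1},q_{j_2},\ldots,q_{j_m})+p_k\Big).$$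
   Context: Notation: $\mathbb N=\{1,2,\ldots\}$, $|\cdot|$ is the Euclidean norm on $\mathbb R^n$, $n\in\mathbb N$ fixed. For functions of $t$, $g(t)=\mathcal O(h(t))$ means there are $T,C>0$ with $|g(t)|\le Ch(t)$ for all $t\ge T$. Empty sums are zero. Iterated logarithms: $L_0(t)=t$, $L_{m+1}(t)=\ln(L_m(t))$ (for $t$ sufficiently large), and $\mathcal L_{m,k}(t)=(L_{m+1}(t),L_{m+2}(t),\ldots,L_{m+k}(t))$ for $k\in\mathbb N$, $m\ge 0$ and $t$ sufficiently large. For $z\in(0,\infty)^k$ and $\alpha\in\mathbb R^k$, $z^\alpha=\prod_{j=1}^kz_j^{\alpha_j}$. For a real linear space $X$, $\mathcal P(k,X)$ is the set of functions $p:(0,\infty)^k\to X$ of the form $p(z)=\sum_{\alpha\in I}c_\alpha z^\alpha$ with $I\subset\mathbb R^k$ non-empty and finite and $c_\alpha\in X$. For $k<m$, $p\in\mathcal P(k,X)$ is identified with the element of $\mathcal P(m,X)$ given by $(z_1,\ldots,z_m)\mapsto p(z_1,\ldots,z_k)$; this identification is used to regard the functions $q_{j_i}$ in the recursion as elements of $\mathcal P(n_k,\mathbb R^n)$. Standing assumptions on $y'=-Ay+G(y)+f(t)$ in $\mathbb R^n$: $A$ is a constant real $n\times n$ matrix which is diagonalizable with positive eigenvalues (i.e. $A=S^{-1}A_0S$ with $S$ invertible and $A_0$ diagonal with positive entries). $G:\mathbb R^n\to\mathbb R^n$ is locally Lipschitz, and there are functions $G_m:\mathbb R^n\to\mathbb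 R^n$, $m\ge 2$, each a homogeneous polynomial of degree $m$, such that for every $N\ge 2$ there exists $\delta>0$ with $|G(y)-\sum_{m=2}^NG_m(y)|=\mathcal O(|y|^{N+\delta})$ as $y\to 0$. For each $m\ge 2$, $\mathcal G_m$ is a (fixed) $m$-linear mapping from $(\mathbb R^n)^m$ to $\mathbb R^n$ with $G_m(y)=\mathcal G_m(y,y,\ldots,y)$ for all $y\in\mathbb R^n$. The forcing $f$ is a function from $(0,\infty)$ to $\mathbb R^n$. Asymptotic expansion: $g(t)\sim\sum_{k=1}^\infty p_k(\mathcal L_{m_*,n_k}(t))L_{m_*}(t)^{-\gamma_k}$, with $(\gamma_k)$ a divergent, strictly increasing sequence of positive numbers and $p_k\in\mathcal P(n_k,\mathbb R^n)$, means that for each $N\in\mathbb N$ there is $\mu>\gamma_N$ with $|g(t)-\sum_{k=1}^Np_k(\mathcal L_{m_*,n_k}(t))L_{m_*}(t)^{-\gamma_k}|=\mathcal O(L_{m_*}(t)^{-\mu})$. *)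

(* Defs.v *)
From HB Require Import structures.
From mathcomp Require Import all_boot all_order all_algebra finmap.
From mathcomp Require Import all_classical all_reals all_analysis.
From mathcomp Require mpoly.
(* The notations of mpoly clash with those of all_analysis; its canonical
   instances (the measure mdeg) are needed. *)
Import -(notations) mpoly.

Set Implicit Arguments.
Unset Strict Implicit.
Unset Printing Implicit Defensive.

Import Order.TTheory GRing.Theory Num.Theory numFieldNormedType.Exports.

Local Open Scope classical_set_scope.
Local Open Scope ring_scope.

(* The sequences indexed by k >= 1 in the mathematics are indexed from 0 here:
   [mu 0], [p 0], ... are the first terms. *)

(* The library norm on ['cV[R]_n] is the sup norm. *)
Definition enorm (R : realType) (n : nat) (v : 'cV[R]_n) : R :=
  Num.sqrt (\sum_(i < n) v i 0 ^+ 2).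

Definition bigO_pinfty (R : realType) (n : nat) (g : R -> 'cV[R]_n)
    (h : R -> R) : Prop :=
  exists T C : R, [/\ 0 < T, 0 < C &
    forall t, T <= t -> enorm (g t) <= C * h t].

Definition bigO_zero (R : realType) (n : nat) (g : 'cV[R]_n -> 'cV[R]_n)
    (h : 'cV[R]_n -> R) : Prop :=
  exists r C : R, [/\ 0 < r, 0 < C &
    forall y, enorm y < r -> enorm (g y) <= C * h y].

(* [ln] is total (0 on nonpositive reals), hence so is [iterlog m]; it is the
   m-th iterated logarithm for t large. *)
Definition iterlog (R : realType) (m : nat) (t : R) : R := iter m (@ln R) t.

Definition iterlogs (R : realType) (m k : nat) (t : R) : 'rV[R]_k :=
  \row_(j < k) iterlog (m + j.+1) t.

Definition posvec (R : realType) (k : nat) (z : 'rV[R]_k) : Prop :=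
  forall j, 0 < z 0 j.

Definition monom (R : realType) (k : nat) (z a : 'rV[R]_k) : R :=
  \prod_(j < k) (z 0 j `^ a 0 j).

(* A function on (0, oo)^k is represented by a function on all row vectors,
   whose values outside the positive orthant are irrelevant. *)
Definition genpoly (R : realType) (X : lmodType R) (k : nat)
    (p : 'rV[R]_k -> X) : Prop :=
  exists (I : {fset 'rV[R]_k}) (c : 'rV[R]_k -> X),
    I != fset0 /\
    forall z, posvec z -> p z = \sum_(a <- I) monom z a *: c a.

(* For k <= m, the first k coordinates (z_1, ..., z_k) of (z_1, ..., z_m).
   For k > m the missing coordinates are set to 0; this case is not used. *)
Definition firstcoords (R : realType) (m k : nat) (z : 'rV[R]_m) : 'rV[R]_k :=
  \row_(i < k) (if insub (val i) is Some j then z 0 j else 0).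

(* The identification of an element of P(k, X) with one of P(m, X), k <= m. *)
Definition genpoly_embed (R : realType) (X : Type) (k m : nat)
    (p : 'rV[R]_k -> X) : 'rV[R]_m -> X :=
  fun z => p (firstcoords k z).

Definition log_expansion (R : realType) (n : nat) (m : nat) (nk : nat -> nat)
    (gamma : nat -> R) (p : forall k, 'rV[R]_(nk k) -> 'cV[R]_n)
    (g : R -> 'cV[R]_n) : Prop :=
  forall N : nat, exists2 mu : R, gamma N < mu &
    bigO_pinfty
      (fun t => g t - \sum_(k < N.+1)
                 (iterlog m t `^ (- gamma k)) *: p k (iterlogs m (nk k) t))
      (fun t => iterlog m t `^ (- mu)).

Definition multilinear (R : realType) (U V : lmodType R) (m : nat)
    (F : ('I_m -> U) -> V) : Prop :=
  forall (v : 'I_m -> U) (i : 'I_m),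
    linear (fun x : U => F [eta v with i |-> x]).

Definition homog_poly_map (R : realType) (n m : nat)
    (g : 'cV[R]_n -> 'cV[R]_n) : Prop :=
  exists P : 'I_n -> mpoly n R,
    (forall i, P i \is ishomog1 m (@mdeg n)) /\
    forall y i, g y i 0 = meval (fun j => y j 0) (P i).

(* The sup norm used by [lipschitz] gives the same notion as the Euclidean
   norm. *)
Definition locally_lipschitz (R : realType) (n : nat)
    (G : 'cV[R]_n -> 'cV[R]_n) : Prop :=
  forall x : 'cV[R]_n, exists2 U, nbhs x U & [lipschitz G z | z in U].

Definition diagonalizable_pos (R : realType) (n : nat) (A : 'M[R]_n) : Prop :=
  exists (S : 'M[R]_n) (d : 'rV[R]_n),
    [/\ S \in unitmx, forall i, 0 < d 0 i & A = invmx S *m diag_mx d *m S].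

(* [\sum_(i \in B)] is the sum of a finitely supported family over a possibly
   infinite set [B] (with value 0 if the support is infinite). Here the supports
   are finite, because [mu] is positive, increasing and divergent. *)
Definition expansion_recursion (R : realType) (n : nat) (A : 'M[R]_n)
    (calG : forall m, ('I_m -> 'cV[R]_n) -> 'cV[R]_n)
    (nk : nat -> nat) (mu : nat -> R)
    (p q : forall k, 'rV[R]_(nk k) -> 'cV[R]_n) : Prop :=
  (forall z, posvec z -> q 0%N z = invmx A *m p 0%N z) /\
  (forall k, (1 <= k)%N -> forall z, posvec z ->
    q k z = invmx A *m
      (\sum_(m \in [set m : nat | (2 <= m)%N])
         \sum_(j \in [set j : m.-tuple nat | \sum_(i < m) mu (tnth j i) = mu k])
           calG m (fun i => genpoly_embed (q (tnth j i)) z)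
       + p k z)).

(* Main.v *)
Require Import Defs.
From HB Require Import structures.
From mathcomp Require Import all_boot all_order all_algebra finmap.
From mathcomp Require Import all_classical all_reals all_analysis.
From mathcomp Require Import ring lra.
Import Order.TTheory GRing.Theory Num.Theory numFieldNormedType.Exports.
Local Open Scope classical_set_scope.
Local Open Scope ring_scope.

(**
  Why the expansion holds.  Write psi for the iterated logarithm L_{m_star}.
  Along psi everything is slow: each factor L_j with j >= 1 has derivative at
  most 1/t in absolute value, and 1/t is smaller than every negative power of
  psi because m_star >= 1.  Hence a term psi^(-gamma) p(L_{m_star+1}, ...) has a
  derivative that is negligible at every order of the expansion
  ([slow_monomial], [slow_genpoly]), and substituting a formal expansion into
  y' = -A y + G(y) + f turns the differential equation into the algebraic one
  A y = G(y) + f.  Solving the latter order by order is the recursion for the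
  q_k ([rec_solution]).

  The factors L_{m_star+1}, L_{m_star+2}, ... grow slower than any power of psi,
  so a term of exponent gamma is O(psi^(-nu)) for every nu < gamma, but in general
  not for nu = gamma.  Orders of magnitude are therefore measured by [decays a], which
  asks for O(psi^(-nu)) for all nu < a.  The claim, proved by induction on N in
  [solution_expansion], is that the difference of y and the sum of the first N
  terms decays at order mu_N (with terms numbered from 0).  Since mu increases
  strictly, the claim at N + 1 gives the required error bound after N + 1 terms
  with an exponent strictly between mu_N and mu_{N+1}.

  Both the base case and the induction step rest on one stability estimate,
  [stable_decay]: if v' = -A v + g and |g| <= eps |v| + C psi^(-nu), with a
  small eps that depends on A only, then v = O(psi^(-nu)).  In
  coordinates that diagonalize A, the squared norm E satisfies
  E' <= -lam E + C psi^(-2 nu); as the logarithmic derivative of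
  psi^(-2 nu) tends to 0, E is dominated by a multiple of it ([comparison_decay]).

  Base case: |G(y)| <= K |y|^2 is absorbed by eps |y| because y tends to 0.
  Step: let v be the difference of y and the first N + 1 terms.  Its forcing g
  consists of the error in the expansion of f, the negligible derivative of the
  terms, and the difference of G(y) and its part at the exponents
  mu_0, ..., mu_N.  For the last one, G is replaced by a Taylor polynomial, y is
  written as the first N terms plus a remainder of order mu_N, and the
  multilinear maps are expanded ([nonlinearity_decays]).  A product of pieces
  has as its order the sum of the orders of its factors.  The exponents form a
  set that is closed under addition, so this sum is either some mu_k with
  k <= N, and then the product involves no remainder (each of its at least two
  factors has an order below mu_k) and cancels against the recursion, or it is
  at least mu_{N+1}, and then the product is an admissible error
  ([calG_product_decays]).
*)

Set Implicit Arguments.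
Unset Strict Implicit.
Unset Printing Implicit Defensive.

(** * Multilinear maps on finite sums *)

Section Multilinear.
Variable R : realType.

(** Prepends an argument, so that statements on m-linear maps go by induction on m. *)
Definition ocons {U : Type} {m : nat} (x : U) (v : 'I_m -> U) : 'I_m.+1 -> U :=
  fun i => if unlift ord0 i is Some j then v j else x.

Lemma ocons0 (U : Type) m (x : U) (v : 'I_m -> U) : ocons x v ord0 = x.
Proof. by rewrite /ocons unlift_none. Qed.

Lemma oconsS (U : Type) m (x : U) (v : 'I_m -> U) j :
  ocons x v (lift ord0 j) = v j.
Proof. by rewrite /ocons liftK. Qed.

Lemma ocons_eta (U : Type) m (v : 'I_m.+1 -> U) :
  v = ocons (v ord0) (fun i => v (lift ord0 i)).
Proof.
by apply: funext => i; rewrite /ocons; case: unliftP => [j ->|->].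
Qed.

Lemma multilinear_ocons (U V : lmodType R) m (F : ('I_m.+1 -> U) -> V) x :
  multilinear F -> multilinear (fun v => F (ocons x v)).
Proof.
move=> Fm v i a u1 u2 /=.
have E y : ocons x [eta v with i |-> y] =
    [eta ocons x v with lift ord0 i |-> y].
  apply: funext => j; rewrite /ocons /=.
  case: unliftP => [k ->|->] /=; last by [].
  by rewrite (inj_eq (@lift_inj _ ord0)).
by rewrite !E Fm.
Qed.

Lemma linear_ocons (U V : lmodType R) m (F : ('I_m.+1 -> U) -> V) v :
  multilinear F -> linear (fun x => F (ocons x v)).
Proof.
move=> Fm a u1 u2 /=.
have E y : ocons y v = [eta ocons 0 v with ord0 |-> y].
  apply: funext => j; rewrite /ocons /=.
  by case: unliftP => [k ->|->] /=; rewrite ?eqxx.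
by rewrite (E (_ + _)) (E u1) (E u2) Fm.
Qed.

Lemma linear_sumE (U V : lmodType R) (f : U -> V) (J : finType) (w : J -> U) :
  linear f -> f (\sum_j w j) = \sum_j f (w j).
Proof.
move=> fl.
pose f' := HB.pack_for {linear U -> V} f (GRing.isLinear.Build R U V *:%R f fl).
rewrite -[f]/(f' : U -> V).
exact: raddf_sum.
Qed.

Lemma linear_scaleE (U V : lmodType R) (f : U -> V) a u :
  linear f -> f (a *: u) = a *: f u.
Proof.
move=> fl.
pose f' := HB.pack_for {linear U -> V} f (GRing.isLinear.Build R U V *:%R f fl).
rewrite -[f]/(f' : U -> V).
exact: linearZ.
Qed.

Lemma multilinear_sum (U V : lmodType R) m (F : ('I_m -> U) -> V)
    (J : finType) (w : 'I_m -> J -> U) :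
  multilinear F ->
  F (fun i => \sum_j w i j) =
  \sum_(s : {ffun 'I_m -> J}) F (fun i => w i (s i)).
Proof.
elim: m F w => [|m IH] F w Fm.
  rewrite (eq_bigr (fun=> F (fun i => \sum_j w i j))).
    by rewrite sumr_const card_ffun card_ord expn0.
  by move=> s _; congr (F _); apply: funext => -[].
rewrite [X in F X]ocons_eta.
rewrite (linear_sumE (f := fun x => F (ocons x _))); last exact: linear_ocons.
under eq_bigr => j _.
  rewrite (IH (fun v => F (ocons (w ord0 j) v))); last first.
    exact: multilinear_ocons.
  over.
rewrite pair_bigA /=; apply/esym.
pose h (p : J * {ffun 'I_m -> J}) : {ffun 'I_m.+1 -> J} :=
  [ffun i => ocons p.1 p.2 i].
pose h' (s : {ffun 'I_m.+1 -> J}) :=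
  (s ord0, [ffun i => s (lift ord0 i)] : {ffun 'I_m -> J}).
have hK : cancel h h'.
  move=> [j s]; rewrite /h /h' ffunE ocons0 /=; congr pair.
  by apply/ffunP => i; rewrite !ffunE oconsS.
have h'K : cancel h' h.
  move=> s; apply/ffunP => i; rewrite /h /h' ffunE /= /ocons.
  by case: unliftP => [k ->|->] //; rewrite ffunE.
rewrite (reindex h) /=; last by exists h' => ? _; [exact: hK|exact: h'K].
apply: eq_bigr => -[j s] _; congr (F _); rewrite [LHS]ocons_eta /h /=.
rewrite ffunE ocons0; congr ocons.
by apply: funext => i; rewrite ffunE oconsS.
Qed.

Lemma multilinear_scale (U V : lmodType R) m (F : ('I_m -> U) -> V)
    (a : 'I_m -> R) (w : 'I_m -> U) :
  multilinear F -> F (fun i => a i *: w i) = (\prod_i a i) *: F w.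
Proof.
elim: m F a w => [|m IH] F a w Fm.
  by rewrite big_ord0 scale1r; congr (F _); apply: funext => -[].
rewrite [X in F X]ocons_eta.
rewrite (linear_scaleE (f := fun x => F (ocons x _))); last exact: linear_ocons.
rewrite (IH (fun v => F (ocons (w ord0) v))); last exact: multilinear_ocons.
by rewrite scalerA big_ord_recl [in RHS](ocons_eta w).
Qed.

(** A multilinear map is a polynomial in the coordinates of its arguments. Both the
    norm bound and the stability of generalized polynomials follow from this. *)
Lemma multilinear_coord (n : nat) (V : lmodType R) m
    (F : ('I_m -> 'cV[R]_n) -> V) v :
  multilinear F ->
  F v = \sum_(s : {ffun 'I_m -> 'I_n})
          (\prod_i v i (s i) 0) *: F (fun i => delta_mx (s i) 0).
Proof.
move=> Fm.
have -> : v = fun i => \sum_(j < n) v i j 0 *: delta_mx j 0.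
  apply: funext => i; rewrite [LHS]matrix_sum_delta.
  by apply: eq_bigr => j _; rewrite big_ord1.
rewrite multilinear_sum //; apply: eq_bigr => s _.
rewrite multilinear_scale //; congr (_ *: _); apply: eq_bigr => i _.
rewrite summxE (bigD1 (s i)) //= big1 ?addr0 => [|j ji].
  by rewrite !mxE !eqxx mulr1.
by rewrite !mxE eq_sym (negPf ji) mulr0.
Qed.

End Multilinear.

(** * Norms, and orders of decay *)

Section Norms.
Variable R : realType.

Lemma coord_le_norm n (v : 'cV[R]_n) i : `|v i 0| <= `|v|.
Proof.
rewrite [leRHS]/Num.Def.normr/= mx_normrE.
exact: (le_bigmax _ (fun ij : 'I_n * 'I_1 => `|v ij.1 ij.2|) (i, 0)).
Qed.

Lemma norm_le_coord n (v : 'cV[R]_n) c :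
  0 <= c -> (forall i, `|v i 0| <= c) -> `|v| <= c.
Proof.
move=> c0 vc; rewrite [leLHS]/Num.Def.normr/= mx_normrE bigmax_le // => -[i j] _.
by rewrite ord1.
Qed.

Lemma norm_le_enorm n (v : 'cV[R]_n) : `|v| <= enorm v.
Proof.
apply: norm_le_coord => [|i]; first exact: sqrtr_ge0.
rewrite -sqrtr_sqr ler_wsqrtr // (bigD1 i) //= lerDl.
by apply: sumr_ge0 => j _; exact: sqr_ge0.
Qed.

Lemma enorm_le_norm n (v : 'cV[R]_n) : enorm v <= n%:R * `|v|.
Proof.
rewrite -[leRHS]ger0_norm ?mulr_ge0 // -sqrtr_sqr ler_wsqrtr //.
apply: (@le_trans _ _ (\sum_(i < n) `|v| ^+ 2)).
  apply: ler_sum => i _; rewrite -[leLHS]real_normK ?num_real //.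
  by rewrite ler_sqr ?nnegrE //; exact: coord_le_norm.
rewrite sumr_const card_ord exprMn -[leLHS]mulr_natl ler_wpM2r ?sqr_ge0 //.
by rewrite -natrX ler_nat; case: n {v} => // n; rewrite expnS leq_pmulr ?expn_gt0.
Qed.

Lemma mulmx_norm_bound m n (M : 'M[R]_(m, n)) :
  exists2 K, 0 < K & forall v : 'cV[R]_n, `|M *m v| <= K * `|v|.
Proof.
exists (\sum_i \sum_j `|M i j| + 1).
  by rewrite ltr_wpDl // sumr_ge0 // => i _; rewrite sumr_ge0.
move=> v; have S0 i : 0 <= \sum_j `|M i j| by rewrite sumr_ge0.
apply: norm_le_coord => [|i].
  by rewrite mulr_ge0 // addr_ge0 // sumr_ge0.
rewrite mxE (le_trans (ler_norm_sum _ _ _)) //.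
apply: (@le_trans _ _ ((\sum_j `|M i j|) * `|v|)).
  rewrite mulr_suml ler_sum // => j _; rewrite normrM ler_wpM2l //.
  exact: coord_le_norm.
rewrite ler_wpM2r // (bigD1 i) //= -addrA lerDl addr_ge0 // sumr_ge0 //.
Qed.

Lemma multilinear_norm_bound n (V : normedModType R) m
    (F : ('I_m -> 'cV[R]_n) -> V) : multilinear F ->
  exists2 K, 0 < K & forall v, `|F v| <= K * \prod_i `|v i|.
Proof.
move=> Fm.
exists (\sum_(s : {ffun 'I_m -> 'I_n}) `|F (fun i => delta_mx (s i) 0)| + 1).
  by rewrite ltr_wpDl // sumr_ge0.
move=> v; rewrite [in leLHS](multilinear_coord v Fm).
rewrite (le_trans (ler_norm_sum _ _ _)) // mulrDl mul1r ler_wpDr ?prodr_ge0 //.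
rewrite mulr_suml ler_sum // => s _; rewrite normrZ mulrC ler_wpM2l //.
rewrite normr_prod ler_prod // => i _; rewrite normr_ge0 /=.
exact: coord_le_norm.
Qed.

Lemma powR_sum (I : finType) (x : R) (a : I -> R) : 0 < x ->
  \prod_i x `^ a i = x `^ \sum_i a i.
Proof.
move=> x0; elim/big_rec2: _ => [|i y z _ ->]; first by rewrite powRr0.
by rewrite powRD // (gt_eqF x0) implybT.
Qed.

End Norms.

Section Decay.
Variables (R : realType) (psi : R -> R).
Hypothesis psi_ge1 : \forall t \near +oo, 1 <= psi t.

(** The function [psi] is the slow scale, later an iterated logarithm. *)
Definition bigO_pow (V : normedModType R) (nu : R) (g : R -> V) : Prop :=
  exists2 C, 0 < C & \forall t \near +oo, `|g t| <= C * psi t `^ (- nu).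

(** The order up to arbitrarily small losses. It ignores the logarithmic factors of
    the coefficients, and it is additive under products. *)
Definition decays (V : normedModType R) (a : R) (g : R -> V) : Prop :=
  forall nu, nu < a -> bigO_pow nu g.

Implicit Types V W : normedModType R.

Lemma bigO_pow_le V nu nu' (g : R -> V) :
  nu' <= nu -> bigO_pow nu g -> bigO_pow nu' g.
Proof.
move=> le_nu [C C0 gC]; exists C => //.
near=> t; have g_le : `|g t| <= C * psi t `^ (- nu) by near: t.
rewrite (le_trans g_le) // ler_wpM2l ?(ltW C0) // ler_powR ?lerN2 //.
by near: t.
Unshelve. all: by end_near. Qed.

Lemma bigO_pow_bounded_by V W nu (g : R -> V) (h : R -> W) K : 0 < K ->
  (\forall t \near +oo, `|g t| <= K * `|h t|) ->
  bigO_pow nu h -> bigO_pow nu g.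
Proof.
move=> K0 gh [C C0 hC]; exists (K * C); first exact: mulr_gt0.
near=> t; have gt : `|g t| <= K * `|h t| by near: t.
rewrite (le_trans gt) // -mulrA ler_wpM2l ?(ltW K0) //; near: t; exact: hC.
Unshelve. all: by end_near. Qed.

Lemma bigO_powD V nu (g h : R -> V) :
  bigO_pow nu g -> bigO_pow nu h -> bigO_pow nu (fun t => g t + h t).
Proof.
move=> [C C0 gC] [D D0 hD]; exists (C + D); first exact: addr_gt0.
near=> t; rewrite (le_trans (ler_normD _ _)) // mulrDl lerD //; near: t => //.
Unshelve. all: by end_near. Qed.

Lemma bigO_pow0 V nu : bigO_pow nu (fun=> 0 : V).
Proof.
by exists 1 => //; near=> t; rewrite normr0 mul1r powR_ge0.
Unshelve. all: by end_near. Qed.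

Lemma bigO_pow_multilinear n V m (F : ('I_m -> 'cV[R]_n) -> V)
    (nu : 'I_m -> R) (w : 'I_m -> R -> 'cV[R]_n) :
  multilinear F -> (forall i, bigO_pow (nu i) (w i)) ->
  bigO_pow (\sum_i nu i) (fun t => F (fun i => w i t)).
Proof.
move=> Fm wO; have [K K0 FK] := multilinear_norm_bound Fm.
have /fin_all_exists[C wC] : forall i, exists C, 0 < C /\
    \forall t \near +oo, `|w i t| <= C * psi t `^ (- nu i).
  by move=> i; have [C C0 wC] := wO i; exists C.
exists (K * \prod_i C i).
  by rewrite mulr_gt0 // prodr_gt0 // => i _; case: (wC i).
near=> t; rewrite (le_trans (FK _)) // -mulrA ler_wpM2l ?(ltW K0) //.
have psi0 : 0 < psi t by apply: (@lt_le_trans _ _ 1) => //; near: t.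
rewrite -sumrN -powR_sum // -big_split /= ler_prod // => i _.
rewrite normr_ge0 /=; move: i; near: t.
by apply: filter_forall => i; case: (wC i).
Unshelve. all: by end_near. Qed.

Lemma decays_le V a b (g : R -> V) : b <= a -> decays a g -> decays b g.
Proof. by move=> ba ga nu nub; apply: ga; exact: lt_le_trans ba. Qed.

Lemma decays_near V a (g h : R -> V) :
  (\forall t \near +oo, g t = h t) -> decays a h -> decays a g.
Proof.
move=> gh ha nu nua; apply: (bigO_pow_bounded_by ltr01 _ (ha nu nua)).
by near=> t; rewrite mul1r; have -> : g t = h t by near: t.
Unshelve. all: by end_near. Qed.

Lemma decaysD V a (g h : R -> V) :
  decays a g -> decays a h -> decays a (fun t => g t + h t).
Proof. by move=> ga ha nu nua; apply: bigO_powD; [exact: ga|exact: ha]. Qed.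

Lemma decays_bounded_by V W a (g : R -> V) (h : R -> W) K : 0 < K ->
  (\forall t \near +oo, `|g t| <= K * `|h t|) -> decays a h -> decays a g.
Proof. by move=> K0 gh ha nu nua; exact: (bigO_pow_bounded_by K0 gh (ha _ nua)). Qed.

Lemma decaysN V a (g : R -> V) : decays a g -> decays a (fun t => - g t).
Proof.
by apply: (@decays_bounded_by _ _ _ _ _ 1) => //; near=> t; rewrite normrN mul1r.
Unshelve. all: by end_near. Qed.

Lemma decaysB V a (g h : R -> V) :
  decays a g -> decays a h -> decays a (fun t => g t - h t).
Proof. by move=> ga ha; apply: decaysD => //; exact: decaysN. Qed.

Lemma decays_sum V a (I : Type) (r : seq I) (P : pred I) (g : I -> R -> V) :
  (forall i, P i -> decays a (g i)) ->
  decays a (fun t => \sum_(i <- r | P i) g i t).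
Proof.
move=> ga; elim: r => [|i r IH].
  rewrite (_ : (fun t => _) = fun=> 0); first by move=> nu _; exact: bigO_pow0.
  by apply: funext => t; rewrite big_nil.
case Pi: (P i); last first.
  rewrite (_ : (fun t => _) = fun t => \sum_(j <- r | P j) g j t) //.
  by apply: funext => t; rewrite big_cons Pi.
rewrite (_ : (fun t => _) = fun t => g i t + \sum_(j <- r | P j) g j t).
  by apply: decaysD => //; exact: ga.
by apply: funext => t; rewrite big_cons Pi.
Qed.

(** The loss nu < \sum_i a i is distributed equally among the m factors. *)
Lemma decays_multilinear n V m (F : ('I_m -> 'cV[R]_n) -> V)
    (a : 'I_m -> R) (w : 'I_m -> R -> 'cV[R]_n) : (0 < m)%N ->
  multilinear F -> (forall i, decays (a i) (w i)) ->
  decays (\sum_i a i) (fun t => F (fun i => w i t)).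
Proof.
move=> m0 Fm wa nu nua; pose e := (\sum_i a i - nu) / m%:R.
have e0 : 0 < e by rewrite divr_gt0 ?ltr0n // subr_gt0.
have -> : nu = \sum_(i < m) (a i - e).
  rewrite sumrB sumr_const card_ord -mulr_natr /e divfK ?pnatr_eq0 -?lt0n //.
  by rewrite opprB addrC subrK.
apply: bigO_pow_multilinear => // i; apply: wa.
by rewrite ltrBlDr ltrDl.
Qed.

End Decay.

(** * Iterated logarithms *)

Section IteratedLog.
Variable R : realType.

Lemma iterlogS m (t : R) : iterlog m.+1 t = ln (iterlog m t).
Proof. by []. Qed.

Lemma iterlog_ge m (M : R) : \forall t \near +oo, M <= iterlog m t.
Proof.
elim: m M => [|m IH] M; first by apply: nbhs_pinfty_ge; rewrite num_real.
near=> t; have Lm : expR M <= iterlog m t by near: t; exact: IH.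
by rewrite -ler_expR iterlogS lnK // posrE (lt_le_trans _ Lm) ?expR_gt0.
Unshelve. all: by end_near. Qed.

Lemma iterlog_gt0 m : \forall t \near +oo, 0 < @iterlog R m t.
Proof.
near=> t; apply: (@lt_le_trans _ _ 1) => //; near: t; exact: iterlog_ge.
Unshelve. all: by end_near. Qed.

Lemma iterlog_le m k : \forall t \near +oo, @iterlog R (m + k) t <= iterlog m t.
Proof.
elim: k => [|k IH]; first by near=> t; rewrite addn0.
near=> t; rewrite addnS; apply: (@le_trans _ _ (iterlog (m + k) t)).
  by apply/ltW/ln_sublinear; near: t; exact: iterlog_gt0.
by near: t.
Unshelve. all: by end_near. Qed.

(** Follows from ln (c x) < c x with c = e / 2: the constant ln c is absorbed by the
    other half of e x. *)
Lemma iterlogS_small m (e : R) : 0 < e ->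
  \forall t \near +oo, iterlog m.+1 t <= e * iterlog m t.
Proof.
move=> e0; have e20 : 0 < e / 2 by rewrite divr_gt0.
near=> t; rewrite iterlogS.
have x0 : 0 < iterlog m t by near: t; exact: iterlog_gt0.
have xe : - ln (e / 2) / (e / 2) <= iterlog m t by near: t; exact: iterlog_ge.
have := ln_sublinear (mulr_gt0 e20 x0).
rewrite lnM ?posrE //; move: xe; rewrite ler_pdivrMr //.
move: (iterlog m t) (ln _) (ln _) => x u v u1 u2; lra.
Unshelve. all: by end_near. Qed.

(** The derivative of L_{m+1} is 1 / (t L_1 ... L_m), and every L_j is at least 1
    eventually. *)
Lemma derive_iterlog m : \forall t \near +oo,
  exists2 d : R, is_derive (t : R) 1 (@iterlog R m.+1) d & `|d| <= t^-1.
Proof.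
elim: m => [|m IH].
  near=> t; have t0 : 0 < t by near: t; apply: nbhs_pinfty_gt; rewrite num_real.
  exists t^-1; last by rewrite ger0_norm // invr_ge0 ltW.
  exact: is_derive1_ln.
near=> t; have [d dd dt] : exists2 d : R,
  is_derive (t : R) 1 (@iterlog R m.+1) d & `|d| <= t^-1 by near: t.
have L1 : 1 <= iterlog m.+1 t by near: t; exact: iterlog_ge.
have L0 : 0 < iterlog m.+1 t by rewrite (lt_le_trans _ L1).
exists ((iterlog m.+1 t)^-1 * d).
  have := is_derive1_ln L0 => dln.
  exact: (@is_derive1_comp _ (@ln R) (@iterlog R m.+1)).
rewrite normrM (le_trans _ dt) // ger0_norm ?invr_ge0 ?(ltW L0) //.
by rewrite ler_piMl // invf_le1.
Unshelve. all: by end_near. Qed.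

(** Turns an eventual equality of functions into an equality near each large point,
    as needed to compare derivatives. *)
Lemma near_pinfty_nbhs (P : R -> Prop) :
  (\forall t \near +oo, P t) ->
  \forall t \near +oo, \forall s \near t, P s.
Proof.
move=> [M [_ MP]]; near=> t.
have Mt : M < t by near: t; apply: nbhs_pinfty_gt; rewrite num_real.
by near=> s; apply: MP; near: s; exact: lt_nbhsr.
Unshelve. all: by end_near. Qed.

End IteratedLog.

Section InverseTime.
Variables (R : realType) (m : nat).
Hypothesis m_gt0 : (0 < m)%N.
Local Notation psi := (@iterlog R m).

(** The real number b is arbitrary: b ln (L_m) = b L_{m+1} is at most ln t eventually,
    because L_{m+1} <= L_2 = o(L_1). This is where m > 0 matters. *)
Lemma inv_le_iterlog_pow (b : R) :
  \forall t \near +oo, t^-1 <= psi t `^ (- b).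
Proof.
have e0 : 0 < (`|b| + 1)^-1 by rewrite invr_gt0 ltr_wpDl.
near=> t.
have t0 : 0 < t by near: t; apply: nbhs_pinfty_gt; rewrite num_real.
have psi0 : 0 < psi t by near: t; exact: iterlog_gt0.
have Lm0 : 0 <= iterlog m.+1 t by near: t; exact: iterlog_ge.
rewrite /powR (gt_eqF psi0) -iterlogS -[t in t^-1]lnK ?posrE // -expRN ler_expR.
have bL : b * iterlog m.+1 t <= (`|b| + 1) * iterlog m.+1 t.
  by rewrite ler_wpM2r // ler_wpDr // ler_norm.
rewrite mulNr lerN2 (le_trans bL) // -ler_pdivlMl ?ltr_wpDl //.
apply: (@le_trans _ _ (iterlog 2 t)).
  by rewrite -[m]prednK // -add2n; near: t; exact: iterlog_le.
by rewrite -[ln t]/(iterlog 1 t); near: t; exact: iterlogS_small.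
Unshelve. all: by end_near. Qed.

End InverseTime.

(** * Slowly varying vector functions *)

Section SlowFunctions.
Variables (R : realType) (m : nat).
Hypothesis m_gt0 : (0 < m)%N.
Local Notation psi := (@iterlog R m).

Lemma iterlog_ge1 : \forall t \near +oo, 1 <= psi t.
Proof. exact: iterlog_ge. Qed.

(** Functions whose derivative may be dropped from the equation at every order. *)
Definition slow n (a : R) (g : R -> 'cV[R]_n) : Prop :=
  decays psi a g /\
  exists g' : R -> 'cV[R]_n,
    (\forall t \near +oo, forall i,
       is_derive (t : R) 1 (fun s => g s i 0) (g' t i 0)) /\
    forall b, decays psi b g'.

Lemma slow_near n a (g h : R -> 'cV[R]_n) :
  (\forall t \near +oo, g t = h t) -> slow a h -> slow a g.
Proof.
move=> gh [ha [h' [dh h'0]]]; split; first exact: decays_near ha.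
exists h'; split => //; near=> t => i.
apply: (@near_eq_is_derive _ _ _ (fun s => h s i 0)).
  have : \forall s \near t, g s = h s by near: t; exact: near_pinfty_nbhs.
  by apply: filterS => s ->.
by move: i; near: t.
Unshelve. all: by end_near. Qed.

Lemma slow_le n a b (g : R -> 'cV[R]_n) : b <= a -> slow a g -> slow b g.
Proof. by move=> ba [ga g'a]; split=> //; exact: decays_le ba ga. Qed.

Lemma slow0 n a : slow a (fun=> 0 : 'cV[R]_n).
Proof.
have d0 b : decays psi b (fun=> 0 : 'cV[R]_n) by move=> nu _; exact: bigO_pow0.
split; first exact: d0.
exists (fun=> 0); split=> //; near=> t => i; rewrite mxE.
exact: is_derive_cst.
Unshelve. all: by end_near. Qed.

Lemma slowD n a (g h : R -> 'cV[R]_n) :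
  slow a g -> slow a h -> slow a (fun t => g t + h t).
Proof.
move=> [ga [g' [dg g'0]]] [ha [h' [dh h'0]]]; split; first exact: decaysD.
exists (fun t => g' t + h' t); split; last by move=> b; exact: decaysD.
near=> t.
have dgt : forall i, is_derive t 1 (fun s => g s i 0) (g' t i 0) by near: t.
have dht : forall i, is_derive t 1 (fun s => h s i 0) (h' t i 0) by near: t.
move=> i.
rewrite (_ : (fun s => _) = (fun s => g s i 0) + (fun s => h s i 0)).
  by rewrite mxE; exact: is_deriveD.
by apply: funext => s; rewrite mxE.
Unshelve. all: by end_near. Qed.

Lemma slow_sum n a (I : Type) (r : seq I) (g : I -> R -> 'cV[R]_n) :
  (forall i, slow a (g i)) -> slow a (fun t => \sum_(i <- r) g i t).
Proof.
move=> ga; elim: r => [|i r IH].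
  by apply: slow_near (slow0 n a); near=> t; rewrite big_nil.
apply: (@slow_near _ _ _ (fun t => g i t + \sum_(i <- r) g i t)).
  by near=> t; rewrite big_cons.
exact: slowD.
Unshelve. all: by end_near. Qed.

Section Monomial.
Variables (gamma : R) (k : nat) (a : 'rV[R]_k).

(** The logarithm of psi^(-gamma) L_{m+1}^(a_0) L_{m+2}^(a_1) ...; it is a linear
    combination of iterated logarithms, which makes its derivative easy to bound. *)
Definition log_weight (t : R) : R :=
  - gamma * iterlog m.+1 t + \sum_(j < k) a 0 j * iterlog (m + j.+2) t.

Lemma expR_log_weight : \forall t \near +oo,
  psi t `^ (- gamma) * monom (iterlogs m k t) a = expR (log_weight t).
Proof.
near=> t.
have L0 : forall j : 'I_k, 0 < iterlog (m + j.+1) t.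
  by near: t; apply: filter_forall => j; exact: iterlog_gt0.
have psi0 : 0 < psi t by near: t; exact: iterlog_gt0.
rewrite /log_weight expRD expR_sum /powR (gt_eqF psi0); congr (_ * _).
rewrite /monom; apply: eq_bigr => j _.
by rewrite mxE /powR (gt_eqF (L0 j)) -iterlogS -addnS.
Unshelve. all: by end_near. Qed.

(** All the L_{m+j+2} are at most L_{m+2} = o(L_{m+1}), so the logarithmic factors cost
    less than the gap gamma - nu. *)
Lemma log_weight_le nu : nu < gamma ->
  \forall t \near +oo, expR (log_weight t) <= psi t `^ (- nu).
Proof.
move=> nug; pose S := \sum_(j < k) `|a 0 j|.
have S0 : 0 <= S by rewrite sumr_ge0.
have e0 : 0 < (gamma - nu) / (S + 1) by rewrite divr_gt0 ?subr_gt0 ?ltr_wpDl.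
near=> t.
have psi0 : 0 < psi t by near: t; exact: iterlog_gt0.
have L0 : forall j : 'I_k, 0 < iterlog (m + j.+2) t.
  by near: t; apply: filter_forall => j; exact: iterlog_gt0.
have L2 : forall j : 'I_k, iterlog (m + j.+2) t <= iterlog m.+2 t.
  near: t; apply: filter_forall => j.
  have -> : (m + j.+2 = m.+2 + j)%N by rewrite !addnS.
  exact: iterlog_le.
have L20 : 0 <= iterlog m.+2 t by near: t; exact: iterlog_ge.
have L12 : iterlog m.+2 t <= (gamma - nu) / (S + 1) * iterlog m.+1 t.
  by near: t; exact: iterlogS_small.
rewrite /powR (gt_eqF psi0) -iterlogS ler_expR /log_weight.
have : \sum_(j < k) a 0 j * iterlog (m + j.+2) t <= S * iterlog m.+2 t.
  rewrite mulr_suml ler_sum // => j _.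
  rewrite (le_trans (ler_norm _)) // normrM ler_wpM2l //.
  by rewrite ger0_norm ?(ltW (L0 j)).
have : S * iterlog m.+2 t <= (S + 1) * iterlog m.+2 t.
  by rewrite ler_wpM2r // lerDl.
have : (S + 1) * iterlog m.+2 t <= (gamma - nu) * iterlog m.+1 t.
  by rewrite -ler_pdivlMl ?ltr_wpDl // mulrA [_^-1 * _]mulrC.
move: (iterlog m.+1 t) (iterlog m.+2 t) (\sum_(j < k) _) => x y z; nra.
Unshelve. all: by end_near. Qed.

Lemma derive_log_weight : exists2 B, 0 < B &
  \forall t \near +oo, exists2 d : R,
    is_derive (t : R) 1 log_weight d & `|d| <= B * t^-1.
Proof.
exists (`|gamma| + \sum_(j < k) `|a 0 j| + 1).
  by rewrite ltr_wpDl // addr_ge0 // sumr_ge0.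
near=> t.
have t0 : 0 <= t^-1.
  by rewrite invr_ge0; near: t; apply: nbhs_pinfty_ge; rewrite num_real.
have [d dd dt] : exists2 d : R, is_derive (t : R) 1 (@iterlog R m.+1) d &
  `|d| <= t^-1 by near: t; exact: derive_iterlog.
have /fin_all_exists2[e de et] : forall j : 'I_k, exists2 d : R,
    is_derive (t : R) 1 (@iterlog R (m + j.+2)) d & `|d| <= t^-1.
  near: t; apply: filter_forall => j; rewrite addnS; exact: derive_iterlog.
exists (- gamma * d + \sum_(j < k) a 0 j * e j).
  rewrite (_ : log_weight = (- gamma \*: @iterlog R m.+1) +
      \sum_(j < k) (a 0 j \*: @iterlog R (m + j.+2))).
    exact: is_deriveD.
  by apply: funext => s; rewrite /log_weight /= fct_sumE.
rewrite (le_trans (ler_normD _ _)) // !mulrDl mul1r ler_wpDr // lerD //.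
  by rewrite normrM normrN ler_wpM2l.
rewrite (le_trans (ler_norm_sum _ _ _)) // mulr_suml ler_sum // => j _.
by rewrite normrM ler_wpM2l.
Unshelve. all: by end_near. Qed.

(** The derivative of exp w is w' exp w = O(exp w / t), and 1/t is below every power of
    psi. *)
Lemma slow_monomial n (c : 'cV[R]_n) :
  slow gamma
    (fun t => psi t `^ (- gamma) *: (monom (iterlogs m k t) a *: c)).
Proof.
have c1 : 0 < `|c| + 1 by rewrite ltr_wpDl.
apply: (@slow_near _ _ _ (fun t => expR (log_weight t) *: c)).
  near=> t; rewrite scalerA; congr (_ *: _); near: t; exact: expR_log_weight.
split=> [nu nug|].
  exists (`|c| + 1) => //; near=> t.
  rewrite normrZ ger0_norm ?expR_ge0 // mulrC ler_pM ?expR_ge0 ?lerDl //.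
  by near: t; exact: log_weight_le.
have [B B0 dB] := derive_log_weight.
exists (fun t => (expR (log_weight t) * 'D_1 log_weight t) *: c); split.
  near=> t => i; have [d dd _] : exists2 d : R,
    is_derive (t : R) 1 log_weight d & `|d| <= B * t^-1 by near: t.
  rewrite (_ : (fun s => _) = c i 0 \*: (expR \o log_weight)).
    rewrite mxE mulrC derive_val; exact: is_deriveZ.
  by apply: funext => s; rewrite mxE /= mulrC.
move=> b nu _; exists (B * (`|c| + 1)); first exact: mulr_gt0.
near=> t; have [d dd dt] : exists2 d : R,
  is_derive (t : R) 1 log_weight d & `|d| <= B * t^-1 by near: t.
have psi0 : 0 < psi t by near: t; exact: iterlog_gt0.
have w_le : expR (log_weight t) <= psi t `^ (- (gamma - 1)).
  by near: t; apply: log_weight_le; rewrite ltrBlDr ltrDl.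
have t_le : t^-1 <= psi t `^ (- (nu - (gamma - 1))).
  by near: t; exact: inv_le_iterlog_pow.
have -> : - nu = - (gamma - 1) - (nu - (gamma - 1)) by ring.
rewrite powRD ?(gt_eqF psi0) ?implybT // derive_val.
rewrite normrZ normrM ger0_norm ?expR_ge0 // mulrC.
rewrite [leRHS](_ : _ = (`|c| + 1) * (psi t `^ (- (gamma - 1)) *
  (B * psi t `^ (- (nu - (gamma - 1)))))); last by ring.
rewrite ler_pM ?mulr_ge0 ?expR_ge0 ?lerDl //.
by rewrite ler_pM ?expR_ge0 // (le_trans dt) // ler_wpM2l // ltW.
Unshelve. all: by end_near. Qed.

End Monomial.

End SlowFunctions.

(** * Generalized polynomials *)

Section GeneralizedPolynomials.
Variable R : realType.

(** Generalized polynomials with a list of monomials, possibly repeated, in place of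
    a finite set of exponents: sums and products need no collection of like terms. *)
Definition monom_sum (X : lmodType R) k (p : 'rV[R]_k -> X) : Prop :=
  exists s : seq ('rV[R]_k * X),
    forall z, posvec z -> p z = \sum_(x <- s) monom z x.1 *: x.2.

Lemma genpoly_monom_sum (X : lmodType R) k (p : 'rV[R]_k -> X) :
  genpoly p <-> monom_sum p.
Proof.
split=> [[I [c [_ pE]]]|[s pE]].
  exists [seq (a, c a) | a <- I] => z z0; by rewrite pE // big_map.
pose I := [fset a in 0 :: [seq x.1 | x <- s]]%fset.
exists I, (fun a => \sum_(x <- s | x.1 == a) x.2); split.
  by apply/fset0Pn; exists 0; rewrite !inE eqxx.
move=> z z0; rewrite pE //.
under [RHS]eq_bigr => a _ do rewrite scaler_sumr.
rewrite (exchange_big_dep xpredT) //= [LHS]big_seq [RHS]big_seq.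
apply: eq_bigr => x xs.
rewrite (eq_bigl (pred1 x.1)) => [|a]; last by rewrite eq_sym.
rewrite -big_filter filter_pred1_uniq ?fset_uniq ?big_seq1 //.
by rewrite !inE map_f ?orbT.
Qed.

Lemma eq_monom_sum (X : lmodType R) k (p q : 'rV[R]_k -> X) :
  (forall z, posvec z -> p z = q z) -> monom_sum q -> monom_sum p.
Proof. by move=> pq [s qE]; exists s => z z0; rewrite pq // qE. Qed.

Lemma monom0 k (z : 'rV[R]_k) : monom z 0 = 1.
Proof. by rewrite /monom big1 // => j _; rewrite mxE powRr0. Qed.

Lemma monomD k (z a b : 'rV[R]_k) :
  posvec z -> monom z (a + b) = monom z a * monom z b.
Proof.
move=> z0; rewrite /monom -big_split; apply: eq_bigr => j _ /=.
by rewrite mxE powRD // (gt_eqF (z0 j)) implybT.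
Qed.

Lemma monom_sum_cst (X : lmodType R) k (c : X) : monom_sum (fun _ : 'rV[R]_k => c).
Proof.
by exists [:: (0, c)] => z _; rewrite big_seq1 /= monom0 scale1r.
Qed.

Lemma monom_sumD (X : lmodType R) k (p q : 'rV[R]_k -> X) :
  monom_sum p -> monom_sum q -> monom_sum (fun z => p z + q z).
Proof.
move=> [s pE] [t qE]; exists (s ++ t) => z z0.
by rewrite big_cat /= pE // qE.
Qed.

Lemma monom_sum_sum (X : lmodType R) k (I : Type) (r : seq I) (P : pred I)
    (p : I -> 'rV[R]_k -> X) :
  (forall i, P i -> monom_sum (p i)) ->
  monom_sum (fun z => \sum_(i <- r | P i) p i z).
Proof.
move=> pm; elim: r => [|i r IH].
  by apply: eq_monom_sum (monom_sum_cst k 0) => z _; rewrite big_nil.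
case Pi: (P i).
  apply: eq_monom_sum (monom_sumD (pm i Pi) IH) => z _.
  by rewrite big_cons Pi.
by apply: eq_monom_sum IH => z _; rewrite big_cons Pi.
Qed.

Lemma monom_sum_linear (X Y : lmodType R) k (f : {linear X -> Y})
    (p : 'rV[R]_k -> X) :
  monom_sum p -> monom_sum (fun z => f (p z)).
Proof.
move=> [s pE]; exists [seq (x.1, f x.2) | x <- s] => z z0.
rewrite pE // linear_sum big_map; apply: eq_bigr => x _; exact: linearZ.
Qed.

Lemma monom_sum_scale (X : lmodType R) k (g : 'rV[R]_k -> R^o)
    (p : 'rV[R]_k -> X) :
  monom_sum g -> monom_sum p -> monom_sum (fun z => g z *: p z).
Proof.
move=> [s gE] [t pE].
exists [seq (x.1 + y.1, (x.2 : R) *: y.2) | x <- s, y <- t] => z z0.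
rewrite gE // pE // scaler_suml big_allpairs_dep /=; apply: eq_bigr => x _.
rewrite scaler_sumr; apply: eq_bigr => y _.
by rewrite monomD // !scalerA mulrAC.
Qed.

Lemma monom_sum_prod k (I : Type) (r : seq I) (g : I -> 'rV[R]_k -> R^o) :
  (forall i, monom_sum (g i)) ->
  monom_sum (fun z => \prod_(i <- r) (g i z : R) : R^o).
Proof.
move=> gm; elim: r => [|i r IH].
  by apply: eq_monom_sum (monom_sum_cst k (1 : R^o)) => z _; rewrite big_nil.
apply: eq_monom_sum (monom_sum_scale (gm i) IH) => z _.
by rewrite big_cons.
Qed.

(** In coordinates, the value is a polynomial in the entries of the arguments. *)
Lemma monom_sum_multilinear n (X : lmodType R) k m
    (F : ('I_m -> 'cV[R]_n) -> X) (p : 'I_m -> 'rV[R]_k -> 'cV[R]_n) :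
  multilinear F -> (forall i, monom_sum (p i)) ->
  monom_sum (fun z => F (fun i => p i z)).
Proof.
move=> Fm pm.
apply: eq_monom_sum => [z _|]; first exact: multilinear_coord.
apply: monom_sum_sum => s _.
apply: (@monom_sum_scale _ _ (fun z => \prod_i p i z (s i) 0 : R^o));
  last exact: monom_sum_cst.
apply: (@monom_sum_prod _ _ _ (fun i z => p i z (s i) 0)) => i.
have [t pE] := pm i.
exists [seq (x.1, (x.2 : 'cV[R]_n) (s i) 0 : R^o) | x <- t] => z z0.
rewrite pE // summxE big_map; apply: eq_bigr => x _; by rewrite mxE.
Qed.

Lemma firstcoordsE k l (z : 'rV[R]_l) (i : 'I_k) (il : (i < l)%N) :
  firstcoords k z 0 i = z 0 (Ordinal il).
Proof. by rewrite mxE insubT. Qed.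

Lemma posvec_firstcoords k l (z : 'rV[R]_l) :
  (k <= l)%N -> posvec z -> posvec (firstcoords k z).
Proof.
by move=> kl z0 j; rewrite (firstcoordsE z (leq_trans (ltn_ord j) kl)).
Qed.

Lemma firstcoords_comp j k l (z : 'rV[R]_l) : (j <= k)%N ->
  firstcoords j (firstcoords k z) = firstcoords j z.
Proof.
move=> jk; apply/rowP => i; rewrite firstcoordsE ?(leq_trans (ltn_ord i)) //.
by move=> ik; rewrite !mxE.
Qed.

Lemma firstcoords_iterlogs m j k (t : R) : (j <= k)%N ->
  firstcoords j (iterlogs m k t) = iterlogs m j t.
Proof.
move=> jk; apply/rowP => i.
by rewrite (firstcoordsE _ (leq_trans (ltn_ord i) jk)) !mxE.
Qed.

(** For l >= k, [firstcoords l] pads the exponents with zeros. *)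
Lemma monom_firstcoords k l (z : 'rV[R]_l) (a : 'rV[R]_k) : (k <= l)%N ->
  monom (firstcoords k z) a = monom z (firstcoords l a).
Proof.
move=> kl; rewrite /monom.
rewrite (bigID (fun j : 'I_l => (j < k)%N)) /= [X in _ * X]big1 ?mulr1.
  rewrite (big_ord_narrow kl); apply: eq_bigr => j _.
  have jl : (j < l)%N by rewrite (leq_trans (ltn_ord j)).
  rewrite (firstcoordsE z jl) (@firstcoordsE l k a (widen_ord kl j) (ltn_ord j)).
  by congr (z 0 _ `^ a 0 _); apply: val_inj.
by move=> j jk; rewrite [X in _ `^ X]mxE insubF ?(negPf jk) ?powRr0.
Qed.

Lemma monom_sum_firstcoords (X : lmodType R) k l (p : 'rV[R]_k -> X) :
  (k <= l)%N -> monom_sum p -> monom_sum (fun z : 'rV[R]_l => p (firstcoords k z)).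
Proof.
move=> kl [s pE]; exists [seq (firstcoords l x.1, x.2) | x <- s] => z z0.
rewrite pE; last exact: posvec_firstcoords.
by rewrite big_map; apply: eq_bigr => x _; rewrite monom_firstcoords.
Qed.

Lemma posvec_iterlogs m k : \forall t \near +oo, posvec (@iterlogs R m k t).
Proof.
near=> t => j; rewrite mxE; move: j; near: t.
by apply: filter_forall => j; exact: iterlog_gt0.
Unshelve. all: by end_near. Qed.

Lemma slow_genpoly m n k gamma (p : 'rV[R]_k -> 'cV[R]_n) : (0 < m)%N ->
  monom_sum p ->
  slow m gamma (fun t => iterlog m t `^ (- gamma) *: p (iterlogs m k t)).
Proof.
move=> m0 [s pE]; apply: (@slow_near _ _ _ _ _ (fun t => \sum_(x <- s)
    iterlog m t `^ (- gamma) *: (monom (iterlogs m k t) x.1 *: x.2))).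
  near=> t; rewrite pE ?scaler_sumr //; near: t; exact: posvec_iterlogs.
by apply: slow_sum => x; exact: slow_monomial.
Unshelve. all: by end_near. Qed.

End GeneralizedPolynomials.

(** * The recursion for the coefficients *)

Section Recursion.
Variables (R : realType) (n : nat) (A : 'M[R]_n).
Variable calG : forall m, ('I_m -> 'cV[R]_n) -> 'cV[R]_n.
Variable mu : nat -> R.
Hypothesis mu_gt0 : forall k, 0 < mu k.
Hypothesis mu_incr : forall i j, (i < j)%N -> mu i < mu j.
Implicit Types P Q : nat -> 'cV[R]_n.

Lemma mu_le i j : (i <= j)%N -> mu i <= mu j.
Proof. by rewrite leq_eqVlt => /predU1P[->//|/mu_incr/ltW]. Qed.

Lemma mu_lt i j : (mu i < mu j) = (i < j)%N.
Proof.
apply/idP/idP => [|/mu_incr//]; apply: contraTT; rewrite -leqNgt -leNgt.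
exact: mu_le.
Qed.

Lemma mu_inj : injective mu.
Proof.
by move=> i j; case: (ltngtP i j) => // /mu_incr lt_mu ij; rewrite ij ltxx in lt_mu.
Qed.

(** There are at least two positive summands, so each of them is strictly below the
    total. This makes the recursion well founded. *)
Lemma index_lt_of_sum_le m (s : 'I_m -> nat) k : (2 <= m)%N ->
  \sum_i mu (s i) <= mu k -> forall i, (s i < k)%N.
Proof.
move=> m2 sk i; rewrite -mu_lt (lt_le_trans _ sk) // (bigD1 i) //= ltrDl.
have [j ji] : exists j : 'I_m, j != i.
  case: m m2 i {s sk} => [//|[//|m _ i]].
  by exists (lift i ord0); rewrite eq_sym neq_lift.
rewrite (bigD1 j) //= ltr_wpDr // sumr_ge0 // => l _; exact/ltW.
Qed.

Definition rec_step k P Q : 'cV[R]_n :=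
  invmx A *m
    (\sum_(m \in [set m : nat | (2 <= m)%N])
       \sum_(j \in [set j : m.-tuple nat | \sum_(i < m) mu (tnth j i) = mu k])
         calG (fun i => Q (tnth j i)) + P k).

(** Course-of-values recursion: the step k + 1 sets the entry k from the entries
    below k. *)
Fixpoint history P k : nat -> 'cV[R]_n :=
  if k is k'.+1 then
    fun j => if j == k' then rec_step k' P (history P k') else history P k' j
  else fun=> 0.

(** The recursion acts on sequences of vectors. Applied to the values p_j(z) at a
    fixed z, it yields the values q_k(z), so the number of variables of q_k does not
    enter the recursion. *)
Definition rec_solution P k : 'cV[R]_n := history P k.+1 k.

Lemma eq_rec_step k P P' Q Q' :
  (forall j, (j < k)%N -> Q j = Q' j) -> P k = P' k ->
  rec_step k P Q = rec_step k P' Q'.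
Proof.
move=> QQ' PP'; rewrite /rec_step PP'; congr (_ *m (_ + _)).
apply: eq_fsbigr => m; rewrite inE /= => m2.
apply: eq_fsbigr => j; rewrite inE /= => jk.
congr calG; apply: funext => i; apply: QQ'.
by apply: (index_lt_of_sum_le m2); rewrite jk.
Qed.

Lemma historyE P k j : (j < k)%N -> history P k j = rec_solution P j.
Proof.
elim: k => // k IH; rewrite ltnS leq_eqVlt => /predU1P[->//|jk] /=.
by rewrite (ltn_eqF jk) IH.
Qed.

Lemma rec_solutionE P k :
  rec_solution P k = rec_step k P (rec_solution P).
Proof.
rewrite {1}/rec_solution /= eqxx; apply: eq_rec_step => // j; exact: historyE.
Qed.

Lemma eq_rec_solution P P' k : (forall j, (j <= k)%N -> P j = P' j) ->
  rec_solution P k = rec_solution P' k.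
Proof.
elim/ltn_ind: k => k IH PP'; rewrite !rec_solutionE.
apply: eq_rec_step => [j jk|]; last exact: PP'.
by apply: IH => // i ij; apply: PP'; rewrite (leq_trans ij) // ltnW.
Qed.

(** With bounds M on the degrees and K on the indices, the sum of the recursion runs
    over finite functions, as does the expansion of a multilinear map on sums. *)
Definition finite_rec_sum (M K k : nat) Q : 'cV[R]_n :=
  \sum_(2 <= m < M.+1)
     \sum_(s : {ffun 'I_m -> 'I_K} | \sum_i mu (s i) == mu k)
       calG (fun i => Q (s i)).

(** A sum of more than M terms of mu exceeds mu k, and the indices in a sum equal to
    mu k are below k. *)
Lemma rec_stepE M K k P Q : (k <= K)%N -> mu k < M.+1%:R * mu 0%N ->
  rec_step k P Q = invmx A *m (finite_rec_sum M K k Q + P k).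
Proof.
move=> kK kM; rewrite /rec_step; congr (_ *m (_ + _)).
rewrite (fsbigE (index_iota 2 M.+1)) ?iota_uniq //=; last 2 first.
- by move=> m /=; rewrite mem_index_iota => /andP[].
- move=> m m2; rewrite mem_index_iota m2 /= -leqNgt => Mm.
  apply: fsbig1 => j /= jk; move: kM; rewrite -jk ltNge.
  case/negP; apply: (@le_trans _ _ (m%:R * mu 0%N)).
    by rewrite ler_wpM2r ?ler_nat // ltW.
  rewrite mulr_natl -[m in _ *+ m]card_ord -sumr_const ler_sum // => i _.
  exact: mu_le.
rewrite /finite_rec_sum big_seq_cond [RHS]big_seq; apply: eq_big => m.
  rewrite mem_index_iota; case: (ltnP 1 m) => //= m2.
  by rewrite mem_set ?andbT.
rewrite mem_index_iota => /andP[/andP[m2 _] _].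
pose h (s : {ffun 'I_m -> 'I_K}) := [tuple (s i : nat) | i < m].
have h_inj : injective h.
  move=> s s' /(congr1 (fun t => tnth t)) ss'; apply/ffunP => i.
  by apply: val_inj; have := congr1 (fun f => f i) ss'; rewrite !tnth_mktuple.
have := @bigfs _ 0 +%R _ [seq h s | s <- enum {: {ffun 'I_m -> 'I_K}}]
  (fun j => \sum_i mu (tnth j i) == mu k)
  (fun j => calG (fun i => Q (tnth j i))).
rewrite map_inj_uniq ?enum_uniq // => /(_ isT) bigfs_h.
have -> : [set j : m.-tuple nat | \sum_i mu (tnth j i) = mu k] =
   [set` (fun j : m.-tuple nat => \sum_i mu (tnth j i) == mu k)].
  by apply/seteqP; split=> j /= /eqP.
rewrite -bigfs_h; last first.
  move=> j /eqP jk; have jK i : (tnth j i < K)%N.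
    by apply: leq_trans kK; apply: index_lt_of_sum_le => //; rewrite jk.
  case/negP; apply/mapP; exists [ffun i => Ordinal (jK i)].
    by rewrite mem_enum.
  by apply: eq_from_tnth => i; rewrite tnth_mktuple ffunE.
rewrite big_map big_enum_cond /=; apply: eq_big => [s|s _].
  by under eq_bigr do rewrite tnth_mktuple.
by congr calG; apply: funext => i; rewrite tnth_mktuple.
Qed.

End Recursion.

(** * Stability of the linear part *)

Section Comparison.
Variable R : realType.

(** The function exp(lam t) (K phi - E) is nondecreasing once K >= 2 C / lam, and it is
    nonnegative at T once K >= E T / phi T. *)
Lemma comparison_decay (T lam C : R) (E phi E' phi' : R -> R) : 0 < lam ->
  (forall t, T <= t -> is_derive t 1 E (E' t)) ->
  (forall t, T <= t -> is_derive t 1 phi (phi' t)) ->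
  (forall t, T <= t -> 0 < phi t) ->
  (forall t, T <= t -> - (lam / 2) * phi t <= phi' t) ->
  (forall t, T <= t -> E' t <= - lam * E t + C * phi t) ->
  exists2 K, 0 < K & forall t, T <= t -> E t <= K * phi t.
Proof.
move=> lam0 dE dphi phi0 phi'_ge E'_le.
pose K := `|2 * C / lam| + `|E T / phi T| + 1.
have K0 : 0 < K by rewrite ltr_wpDl // addr_ge0.
have KC : C <= lam / 2 * K.
  have : 2 * C / lam <= K.
    by rewrite /K -addrA ler_wpDr ?addr_ge0 // ler_norm.
  by rewrite ler_pdivrMr // => K_ge; lra.
exists K => // t Tt.
pose H s := expR (lam * s) * (K * phi s - E s).
have dH s : T <= s -> is_derive s 1 H
    (expR (lam * s) * (K * phi' s - E' s + lam * (K * phi s - E s))).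
  move=> Ts; have ? := dE s Ts; have ? := dphi s Ts.
  have ? : is_derive s 1 (fun s => expR (lam * s)) (expR (lam * s) * lam).
    apply: (@is_derive1_comp _ (@expR R) (lam \*: id)).
    by apply: is_derive_eq; rewrite /= /GRing.scale /= mulr1.
  rewrite (_ : H = (fun s => expR (lam * s)) * (K \*: phi - E)) //.
  apply: is_derive_eq; rewrite /GRing.scale /=.
  by rewrite -[(_ - E) s]/(K * phi s - E s); ring.
have H_ge0 s : (0 <= H s) = (E s <= K * phi s).
  by rewrite /H pmulr_rge0 ?expR_gt0 // subr_ge0.
have HT : 0 <= H T.
  rewrite H_ge0 -ler_pdivrMr ?phi0 //.
  by rewrite /K addrAC ler_wpDl ?addr_ge0 // ler_norm.
have H'_ge0 s : T <= s ->
    0 <= expR (lam * s) * (K * phi' s - E' s + lam * (K * phi s - E s)).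
  move=> Ts; rewrite mulr_ge0 ?expR_ge0 //.
  have := E'_le s Ts; have := phi'_ge s Ts; have := phi0 s Ts.
  have -> : K * phi' s - E' s + lam * (K * phi s - E s) =
    K * (phi' s - - (lam / 2) * phi s) + (lam / 2 * K - C) * phi s +
    (- lam * E s + C * phi s - E' s) by field.
  move=> p0 p1 p2; apply: addr_ge0; last by rewrite subr_ge0.
  by apply: addr_ge0; rewrite mulr_ge0 ?subr_ge0 // ltW.
rewrite -H_ge0 (le_trans HT) //; clearbody H.
apply: (@ger0_derive1_ndecry _ H T) => // [s|s|].
- by rewrite in_itv /= andbT => /ltW/dH [].
- rewrite in_itv /= andbT => /ltW Ts; have dHs := dH s Ts.
  by rewrite derive1E derive_val; exact: H'_ge0.
- apply: derivable_within_continuous => s; rewrite in_itv /= andbT => Ts.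
  by have [] := dH s Ts.
Qed.

End Comparison.

Section StableLinear.
Variables (R : realType) (n : nat).

Lemma is_derive_mulmx (S : 'M[R]_n) (v : R -> 'cV[R]_n) (w : 'cV[R]_n) (t : R) :
  (forall i, is_derive t 1 (fun s => v s i 0) (w i 0)) ->
  forall i, is_derive t 1 (fun s => (S *m v s) i 0) ((S *m w) i 0).
Proof.
move=> dv i.
rewrite (_ : (fun s => _) = \sum_j (S i j \*: (fun s => v s j 0))).
  by rewrite mxE; exact: is_derive_sum.
by apply: funext => s; rewrite mxE fct_sumE.
Qed.

Lemma diagonal_gap (d : 'rV[R]_n) : (forall i, 0 < d 0 i) ->
  exists2 lam, 0 < lam & forall i, lam <= d 0 i.
Proof.
move=> d0; exists (\big[Num.min/1]_i d 0 i).
  by apply: lt_bigmin.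
by move=> i; exact: bigmin_le_cond.
Qed.

Variable m : nat.
Local Notation psi := (@iterlog R m).

(** Lyapunov estimate: E = |S v|^2 with S diagonalizing A, compared with
    phi = psi^(-2 nu), whose logarithmic derivative tends to 0. *)
Lemma stable_decay (A : 'M[R]_n) : diagonalizable_pos A ->
  exists2 eps, 0 < eps & forall (nu C : R) (v g : R -> 'cV[R]_n),
    (\forall t \near +oo, forall i,
       is_derive (t : R) 1 (fun s => v s i 0) ((- (A *m v t) + g t) i 0)) ->
    (\forall t \near +oo, `|g t| <= eps * `|v t| + C * psi t `^ (- nu)) ->
    bigO_pow psi nu v.
Proof.
move=> [S [d [Su d0 AE]]]; have [lam lam0 lam_le] := diagonal_gap d0.
have [K1 K10 SK1] := mulmx_norm_bound S.
have [K2 K20 SK2] := mulmx_norm_bound (invmx S).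
(* Chosen so that the part of g bounded by eps |v| uses up at most half of lam. *)
pose eps := lam / (2 * n.+1%:R * K1 * K2).
have eps0 : 0 < eps by rewrite divr_gt0 // !mulr_gt0.
exists eps => // nu C v g dv g_le.
pose u t := S *m v t; pose h t := S *m g t.
have v_le t : `|v t| <= K2 * `|u t| by rewrite -{1}[v t](mulKmx Su) SK2.
pose E t := \sum_i u t i 0 ^+ 2.
have u2_le t : `|u t| ^+ 2 <= E t.
  rewrite -[E t]sqr_sqrtr ?sumr_ge0 // => [|i _]; last exact: sqr_ge0.
  by rewrite ler_pXn2r ?nnegrE ?sqrtr_ge0 //; exact: norm_le_enorm.
pose E' t := \sum_i (2 * u t i 0 * (- d 0 i * u t i 0 + h t i 0)).
have dE : \forall t \near +oo, is_derive (t : R) 1 E (E' t).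
  near=> t.
  have dvt : forall i, is_derive (t : R) 1 (fun s => v s i 0)
    ((- (A *m v t) + g t) i 0) by near: t.
  have dut := is_derive_mulmx S dvt.
  rewrite (_ : E = \sum_i (fun s => u s i 0) ^+ 2); last first.
    by apply: funext => s; rewrite fct_sumE.
  apply: is_derive_sum => i; have duti := dut i.
  apply: is_derive_eq; rewrite /GRing.scale /= expr1; congr (_ * _).
  rewrite mulmxDr mulmxN AE !mulmxA mulmxV // mul1mx -mulmxA.
  by rewrite mxE [in LHS]mxE mul_diag_mx mxE mulNr.
pose phi (t : R) := expR (- (2 * nu) * iterlog m.+1 t).
have phiE : \forall t \near +oo, phi t = (psi t `^ (- nu)) ^+ 2.
  near=> t; have psi0 : 0 < psi t by near: t; exact: iterlog_gt0.
  rewrite /phi /powR (gt_eqF psi0) -expRM_natl -iterlogS; congr expR; ring.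
pose phi' (t : R) := phi t * (- (2 * nu) * 'D_1 (iterlog m.+1) t).
have dphi : \forall t \near +oo, is_derive (t : R) 1 phi (phi' t) /\
    - (lam / 2 / 2) * phi t <= phi' t.
  near=> t.
  have [e de et] : exists2 e : R, is_derive (t : R) 1 (@iterlog R m.+1) e &
    `|e| <= t^-1 by near: t; exact: derive_iterlog.
  have t0 : 0 < t by near: t; apply: nbhs_pinfty_gt; rewrite num_real.
  have t_ge : `|2 * nu| / (lam / 2 / 2) <= t.
    by near: t; apply: nbhs_pinfty_ge; rewrite num_real.
  rewrite /phi' derive_val; split.
    apply: (@is_derive1_comp _ (@expR R) (- (2 * nu) \*: iterlog m.+1)).
  rewrite mulrC ler_pM2l ?expR_gt0 // lerNl -mulNr opprK.
  rewrite (le_trans (ler_norm _)) // normrM.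
  apply: (@le_trans _ _ (`|2 * nu| * t^-1)); first by rewrite ler_wpM2l.
  by rewrite ler_pdivrMr // [leRHS]mulrC -ler_pdivrMr // !divr_gt0.
pose C' := n%:R / lam * (2 * K1 ^+ 2 * C ^+ 2).
have E'_le : \forall t \near +oo, E' t <= - (lam / 2) * E t + C' * phi t.
  near=> t.
  have gt : `|g t| <= eps * `|v t| + C * psi t `^ (- nu) by near: t.
  have -> : phi t = psi t `^ (- nu) ^+ 2 by near: t.
  have h2 i : h t i 0 ^+ 2 <=
      2 * K1 ^+ 2 * (eps ^+ 2 * K2 ^+ 2 * E t + C ^+ 2 * psi t `^ (- nu) ^+ 2).
    apply: (@le_trans _ _
        ((K1 * (eps * `|v t| + C * psi t `^ (- nu))) ^+ 2)).
      have gK0 : 0 <= K1 * (eps * `|v t| + C * psi t `^ (- nu)).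
        by rewrite mulr_ge0 ?(ltW K10) // (le_trans _ gt).
      rewrite -[leLHS]real_normK ?num_real // ler_pXn2r ?nnegrE //.
      rewrite (le_trans (coord_le_norm _ _)) // (le_trans (SK1 _)) //.
      by rewrite ler_wpM2l // ltW.
    have v2 : `|v t| ^+ 2 <= K2 ^+ 2 * E t.
      apply: (@le_trans _ _ ((K2 * `|u t|) ^+ 2)).
        by rewrite ler_pXn2r ?nnegrE ?mulr_ge0 ?(ltW K20).
      by rewrite exprMn ler_wpM2l ?sqr_ge0.
    rewrite exprMn [leRHS]mulrAC [leRHS]mulrC ler_wpM2l ?sqr_ge0 //.
    have := ler_wpM2l (sqr_ge0 eps) v2; have := sqr_ge0
      (eps * `|v t| - C * psi t `^ (- nu)).
    move: (psi t `^ (- nu)) `|v t| (E t) => x y z; nra.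
  have eps_small : n%:R / lam * (2 * K1 ^+ 2 * (eps ^+ 2 * K2 ^+ 2)) <= lam / 2.
    have -> : n%:R / lam * (2 * K1 ^+ 2 * (eps ^+ 2 * K2 ^+ 2)) =
        n%:R / n.+1%:R ^+ 2 * (lam / 2).
      by rewrite /eps; field; rewrite !gt_eqF // ltr0n.
    rewrite ler_piMl ?divr_ge0 ?(ltW lam0) // ler_pdivrMr ?exprn_gt0 //.
    by rewrite mul1r -natrX ler_nat (leq_trans (leqnSn n)) // expnS leq_pmulr.
  set H := 2 * K1 ^+ 2 * (eps ^+ 2 * K2 ^+ 2 * E t +
    C ^+ 2 * psi t `^ (- nu) ^+ 2) in h2.
  apply: (@le_trans _ _ (\sum_i (- lam * u t i 0 ^+ 2 + H / lam))).
    apply: ler_sum => i _; set x := u t i 0; set w := h t i 0.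
    have : (d 0 i - lam) * x ^+ 2 >= 0.
      by rewrite mulr_ge0 ?sqr_ge0 // subr_ge0.
    have : w ^+ 2 / lam <= H / lam by rewrite ler_pM2r ?invr_gt0 //; exact: h2.
    (* Young's inequality: 2 x w <= lam x^2 + w^2 / lam. *)
    have : 0 <= (lam * x - w) ^+ 2 / lam by rewrite divr_ge0 ?sqr_ge0 // ltW.
    have -> : (lam * x - w) ^+ 2 / lam = lam * x ^+ 2 - 2 * x * w + w ^+ 2 / lam.
      by field; rewrite gt_eqF.
    move: (w ^+ 2 / lam) (H / lam) => p q; nra.
  rewrite big_split /= -mulr_sumr sumr_const card_ord -[_ *+ n]mulr_natl -/(E t).
  have -> : n%:R * (H / lam) =
      n%:R / lam * (2 * K1 ^+ 2 * (eps ^+ 2 * K2 ^+ 2)) * E t +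
      C' * psi t `^ (- nu) ^+ 2 by rewrite /H /C'; ring.
  rewrite addrA lerD2r.
  have E0 : 0 <= E t by rewrite (le_trans _ (u2_le t)) ?sqr_ge0.
  have := ler_wpM2r E0 eps_small; lra.
have [T [_ TP]] : \forall t \near +oo,
  [/\ is_derive (t : R) 1 E (E' t), is_derive (t : R) 1 phi (phi' t),
      - (lam / 2 / 2) * phi t <= phi' t & E' t <= - (lam / 2) * E t + C' * phi t].
  near=> t; have [] : is_derive (t : R) 1 phi (phi' t) /\
    - (lam / 2 / 2) * phi t <= phi' t by near: t.
  by split => //; near: t.
have TP' t : T + 1 <= t -> T < t by apply: lt_le_trans; rewrite ltrDl.
have [K K0 EK] := @comparison_decay R (T + 1) (lam / 2) C' E phi E' phi'
  (divr_gt0 lam0 (ltr0n _ 2))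
  (fun t Tt => let: And4 H _ _ _ := TP t (TP' t Tt) in H)
  (fun t Tt => let: And4 _ H _ _ := TP t (TP' t Tt) in H)
  (fun t Tt => expR_gt0 _)
  (fun t Tt => let: And4 _ _ H _ := TP t (TP' t Tt) in H)
  (fun t Tt => let: And4 _ _ _ H := TP t (TP' t Tt) in H).
exists (K2 * Num.sqrt K); first by rewrite mulr_gt0 ?sqrtr_gt0.
near=> t; rewrite (le_trans (v_le t)) // -mulrA ler_wpM2l ?(ltW K20) //.
rewrite -(@ler_pXn2r _ 2) ?nnegrE ?mulr_ge0 ?sqrtr_ge0 ?powR_ge0 //.
rewrite (le_trans (u2_le t)) // exprMn sqr_sqrtr ?(ltW K0) //.
have <- : phi t = psi t `^ (- nu) ^+ 2 by near: t.
apply: EK; near: t; apply: nbhs_pinfty_ge; rewrite num_real.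
Unshelve. all: by end_near. Qed.

End StableLinear.

(** * The expansion of the solution *)

Section Nonlinearity.
Variables (R : realType) (n : nat) (G : 'cV[R]_n -> 'cV[R]_n).
Variable Gm : nat -> 'cV[R]_n -> 'cV[R]_n.
Hypothesis G_expansion : forall N, (2 <= N)%N -> exists2 delta : R, 0 < delta &
  bigO_zero (fun y => G y - \sum_(2 <= m < N.+1) Gm m y)
            (fun y => enorm y `^ (N%:R + delta)).
Variable calG : forall m : nat, ('I_m -> 'cV[R]_n) -> 'cV[R]_n.
Hypothesis calG_multilinear : forall m, (2 <= m)%N -> multilinear (@calG m).
Hypothesis calG_diag :
  forall m, (2 <= m)%N -> forall y, Gm m y = calG (fun _ : 'I_m => y).

Lemma remainder_bound M : (2 <= M)%N ->
  exists K r, [/\ 0 < K, 0 < r & forall y, `|y| < r ->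
    `|G y - \sum_(2 <= m < M.+1) Gm m y| <= K * `|y| ^+ M].
Proof.
move=> M2; have [delta delta0 [r [C [r0 C0 GC]]]] := G_expansion M2.
have n1 : 0 < n.+1%:R :> R by rewrite ltr0n.
exists (C * n.+1%:R ^+ M), (Num.min r 1 / n.+1%:R); split.
- by rewrite mulr_gt0 ?exprn_gt0.
- by rewrite divr_gt0 // lt_min r0 ltr01.
move=> y; rewrite ltr_pdivlMr // => y_lt.
have ey : enorm y <= n.+1%:R * `|y|.
  by rewrite (le_trans (enorm_le_norm y)) // ler_wpM2r // ler_nat.
have ey_lt : enorm y < Num.min r 1 by rewrite (le_lt_trans ey) // mulrC.
move: ey_lt; rewrite lt_min => /andP[/GC Gy e1].
rewrite (le_trans (norm_le_enorm _)) // (le_trans Gy) // -mulrA ler_wpM2l ?(ltW C0) //.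
rewrite -exprMn; have e0 : 0 <= enorm y by exact: sqrtr_ge0.
apply: (@le_trans _ _ (enorm y ^+ M)); last first.
  by rewrite lerXn2r // nnegrE mulr_ge0 // ltW.
move: e0; rewrite le_eqVlt => /predU1P[<-|e0].
  by rewrite powR0 ?exprn_ge0 // gt_eqF // ltr_wpDl.
by rewrite -powR_mulrn ?(ltW e0) // ger_powR ?e0 ?(ltW e1) // lerDl ltW.
Qed.

(** The expansion at N = 2 suffices: G_2 is bounded through its bilinear map. *)
Lemma quadratic_bound : exists K r, [/\ 0 < K, 0 < r &
  forall y, `|y| < r -> `|G y| <= K * `|y| ^+ 2].
Proof.
have [K [r [K0 r0 GK]]] := remainder_bound (leqnn 2).
have [B B0 FB] := multilinear_norm_bound (calG_multilinear (leqnn 2)).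
exists (K + B), r; split => //; first exact: addr_gt0.
move=> y /GK; rewrite big_nat1 => Gy.
rewrite -[G y](subrK (Gm 2 y)) (le_trans (ler_normD _ _)) // mulrDl lerD //.
rewrite calG_diag // (le_trans (FB _)) // ler_wpM2l ?(ltW B0) //.
by rewrite prodr_const card_ord.
Qed.

End Nonlinearity.

Section Expansion.
Variables (R : realType) (n : nat) (A : 'M[R]_n).
Hypothesis A_diag : diagonalizable_pos A.
Variable G : 'cV[R]_n -> 'cV[R]_n.
Variable Gm : nat -> 'cV[R]_n -> 'cV[R]_n.
Hypothesis G_expansion : forall N, (2 <= N)%N -> exists2 delta : R, 0 < delta &
  bigO_zero (fun y => G y - \sum_(2 <= m < N.+1) Gm m y)
            (fun y => enorm y `^ (N%:R + delta)).
Variable calG : forall m : nat, ('I_m -> 'cV[R]_n) -> 'cV[R]_n.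
Hypothesis calG_multilinear : forall m, (2 <= m)%N -> multilinear (@calG m).
Hypothesis calG_diag :
  forall m, (2 <= m)%N -> forall y, Gm m y = calG (fun _ : 'I_m => y).
Variable mstar : nat.
Local Notation psi := (@iterlog R mstar).
Local Notation decays := (decays psi).
Variable mu : nat -> R.
Hypothesis mu_gt0 : forall k, 0 < mu k.
Hypothesis mu_incr : forall i j, (i < j)%N -> mu i < mu j.
Hypothesis mu_add : forall x y, range mu x -> range mu y -> range mu (x + y).
Variables (P Q : nat -> R -> 'cV[R]_n).

Definition term k (t : R) : 'cV[R]_n := psi t `^ (- mu k) *: Q k t.

Hypothesis term_slow : forall k, slow mstar (mu k) (term k).
Hypothesis Q_rec : forall M K k t, (k <= K)%N -> mu k < M.+1%:R * mu 0%N ->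
  A *m Q k t = finite_rec_sum calG mu M K k (Q^~ t) + P k t.
Variable f : R -> 'cV[R]_n.
Hypothesis f_decays : forall N,
  decays (mu N) (fun t => f t - \sum_(k < N) psi t `^ (- mu k) *: P k t).
Variable y : R -> 'cV[R]_n.
Hypothesis y_deriv : \forall t \near +oo, forall i,
  is_derive (t : R) 1 (fun s => y s i 0) ((- (A *m y t) + G (y t) + f t) i 0).
Hypothesis y_cvg0 : y t @[t --> +oo] --> (0 : 'cV[R]_n).

Let psi_ge1 := iterlog_ge1 R mstar.

Definition partial_sum N (t : R) : 'cV[R]_n := \sum_(k < N) term k t.

Lemma mu_sum m (s : 'I_m.+1 -> nat) : exists k, \sum_i mu (s i) = mu k.
Proof.
suff [k _ <-] : range mu (\sum_i mu (s i)) by exists k.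
elim: m s => [|m IH] s; first by rewrite big_ord1; exists (s ord0).
rewrite big_ord_recl; apply: mu_add; last exact: IH.
by exists (s ord0).
Qed.

Lemma y_small (e : R) : 0 < e -> \forall t \near +oo, `|y t| < e.
Proof.
by move=> e0; move/cvgr0Pnorm_lt: y_cvg0; exact.
Qed.

(** The quadratic nonlinearity is smaller than eps |y| because y tends to 0, so the
    linear part alone determines the first order of decay. *)
Lemma y_decays : decays (mu 0%N) y.
Proof.
move=> nu nu_lt; have [eps eps0 stable] := stable_decay mstar A_diag.
have [K [r [K0 r0 GK]]] := quadratic_bound G_expansion calG_multilinear calG_diag.
have [C C0 fC] := f_decays nu_lt.
apply: (stable nu C y (fun t => G (y t) + f t)).
  by apply: filterS y_deriv => t; rewrite addrA.
near=> t.
have ft : `|f t - \sum_(k < 0) psi t `^ (- mu k) *: P k t| <= C * psi t `^ (- nu).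
  by near: t.
rewrite big_ord0 subr0 in ft.
rewrite (le_trans (ler_normD _ _)) // lerD //.
have yr : `|y t| < r by near: t; exact: y_small.
have yeps : `|y t| < eps / K by near: t; apply: y_small; exact: divr_gt0.
rewrite (le_trans (GK _ yr)) // expr2 mulrA ler_wpM2r // mulrC -ler_pdivlMr //.
exact: ltW.
Unshelve. all: by end_near. Qed.

(** Since y = O(psi^(-mu_0 / 2)), the Taylor remainder of degree M is
    O(psi^(-M mu_0 / 2)). *)
Lemma remainder_decays M a : (2 <= M)%N -> 2 * a <= M%:R * mu 0%N ->
  decays a (fun t => G (y t) - \sum_(2 <= m < M.+1) Gm m (y t)).
Proof.
move=> M2 aM; have [K [r [K0 r0 GK]]] := remainder_bound G_expansion M2.
have [|C C0 yC] := @y_decays (mu 0%N / 2).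
  by have := mu_gt0 0%N; lra.
move=> nu nua; exists (K * C ^+ M); first by rewrite mulr_gt0 ?exprn_gt0.
near=> t.
have yr : `|y t| < r by near: t; exact: y_small.
have yt : `|y t| <= C * psi t `^ (- (mu 0%N / 2)) by near: t.
rewrite (le_trans (GK _ yr)) // -mulrA ler_wpM2l ?(ltW K0) //.
apply: (@le_trans _ _ ((C * psi t `^ (- (mu 0%N / 2))) ^+ M)).
  by rewrite lerXn2r ?nnegrE // (le_trans _ yt).
rewrite exprMn ler_wpM2l ?exprn_ge0 ?(ltW C0) //.
rewrite -powR_mulrn ?powR_ge0 // -powRrM.
apply: ler_powR; last by lra.
by near: t.
Unshelve. all: by end_near. Qed.

Section Step.
Variable N : nat.
Hypothesis IH : decays (mu N) (fun t => y t - partial_sum N t).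

(** Splits y into N terms and the remainder, which takes the index N: in every case
    the piece of index k has order mu k. *)
Definition piece (k : nat) (t : R) : 'cV[R]_n :=
  if (k < N)%N then term k t else y t - partial_sum N t.

Lemma sum_piece t : \sum_(k < N.+1) piece k t = y t.
Proof.
rewrite big_ord_recr /= /piece ltnn.
rewrite (eq_bigr (fun k : 'I_N => term k t)) => [|k _]; last by rewrite ltn_ord.
by rewrite -/(partial_sum N t) addrC subrK.
Qed.

Lemma piece_decays (k : 'I_N.+1) : decays (mu k) (piece k).
Proof.
rewrite /piece; case: ltnP => kN; first by have [] := term_slow k.
by have -> : (k : nat) = N by apply/eqP; rewrite eqn_leq kN -ltnS ltn_ord.
Qed.

Lemma calG_terms m (s : 'I_m -> nat) t : (2 <= m)%N -> 0 < psi t ->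
  calG (fun i => term (s i) t) =
  psi t `^ (- \sum_i mu (s i)) *: calG (fun i => Q (s i) t).
Proof.
move=> m2 psi0; rewrite /term.
rewrite (multilinear_scale (fun i => psi t `^ (- mu (s i)))
  (fun i => Q (s i) t) (calG_multilinear m2)).
by rewrite powR_sum // sumrN.
Qed.

(** The exponent of the product is some mu k. If k <= N, the product contains no
    remainder and equals the subtracted term; otherwise its order is at least
    mu (N + 1). *)
Lemma calG_product_decays m (s : {ffun 'I_m -> 'I_N.+1}) : (2 <= m)%N ->
  decays (mu N.+1) (fun t => calG (fun i => piece (s i) t) -
    \sum_(k < N.+1 | \sum_i mu (s i) == mu k)
      psi t `^ (- mu k) *: calG (fun i => Q (s i) t)).
Proof.
move=> m2; have [k sk] : exists k, \sum_i mu (s i) = mu k.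
  by case: m m2 s => // m _ s; exact: mu_sum.
have [kN|Nk] := ltnP k N.+1.
  have s_lt i : (s i < N)%N.
    apply: (index_lt_of_sum_le mu_gt0 mu_incr m2 (s := fun i => s i)).
    by rewrite sk mu_le.
  apply: (@decays_near _ _ _ _ _ (fun=> 0)); last first.
    by move=> nu _; exact: bigO_pow0.
  near=> t; have psi0 : 0 < psi t by near: t; exact: iterlog_gt0.
  rewrite (big_pred1 (Ordinal kN)) => [|j]; last first.
    by rewrite sk (inj_eq (mu_inj mu_incr)) eq_sym.
  rewrite (_ : calG _ = calG (fun i => term (s i) t)).
    by rewrite calG_terms // sk subrr.
  by congr calG; apply: funext => i; rewrite /piece s_lt.
apply: (@decays_near _ _ _ _ _ (fun t => calG (fun i => piece (s i) t))).
  near=> t; rewrite big_pred0 ?subr0 // => j; rewrite sk; apply/eqP => kj.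
  have := mu_incr (leq_trans (ltn_ord j) Nk).
  by rewrite kj ltxx.
apply: (@decays_le _ _ _ (\sum_i mu (s i))); first by rewrite sk mu_le.
apply: decays_multilinear => //; first exact: ltnW.
  exact: calG_multilinear.
by move=> i; exact: piece_decays.
Unshelve. all: by end_near. Qed.

(** Expanding the multilinear maps gives one product for each choice of pieces; these
    products are matched one by one with the terms of the recursion. *)
Lemma nonlinearity_decays M : (2 <= M)%N -> 2 * mu N.+1 <= M%:R * mu 0%N ->
  decays (mu N.+1) (fun t => G (y t) -
    \sum_(k < N.+1) psi t `^ (- mu k) *:
      finite_rec_sum calG mu M N.+1 k (Q^~ t)).
Proof.
move=> M2 muM.
apply: (@decays_near _ _ _ _ _ (fun t =>
  (G (y t) - \sum_(2 <= m < M.+1) Gm m (y t)) +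
  \sum_(2 <= m < M.+1) (\sum_(s : {ffun 'I_m -> 'I_N.+1})
     (calG (fun i => piece (s i) t) -
      \sum_(k < N.+1 | \sum_i mu (s i) == mu k)
        psi t `^ (- mu k) *: calG (fun i => Q (s i) t))))).
  near=> t.
  rewrite -[RHS]addrA [X in _ = _ + X]addrC; congr (_ + _).
  rewrite -[RHS]sumrB.
  have -> : \sum_(k < N.+1) psi t `^ (- mu k) *:
      finite_rec_sum calG mu M N.+1 k (Q^~ t) =
    \sum_(2 <= m < M.+1) \sum_(s : {ffun 'I_m -> 'I_N.+1})
      \sum_(k < N.+1 | \sum_i mu (s i) == mu k)
        psi t `^ (- mu k) *: calG (fun i => Q (s i) t).
    under eq_bigr => k _ do rewrite scaler_sumr.
    rewrite exchange_big /=; apply: eq_bigr => m _.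
    under eq_bigr => k _ do rewrite scaler_sumr.
    by rewrite (exchange_big_dep xpredT).
  rewrite -sumrN; apply: eq_big_nat => m /andP[m2 _].
  rewrite sumrB addrAC -[LHS]add0r; congr (_ - _).
  rewrite calG_diag // -[in X in _ = _ - X](sum_piece t).
  rewrite (multilinear_sum (fun _ (k : 'I_N.+1) => piece k t) (calG_multilinear m2)).
  by rewrite subrr.
apply: decaysD; first exact: remainder_decays.
rewrite (_ : (fun t => _) = fun t => \sum_(m <- index_iota 2 M.+1 | (2 <= m)%N)
   \sum_(s : {ffun 'I_m -> 'I_N.+1})
     (calG (fun i => piece (s i) t) -
      \sum_(k < N.+1 | \sum_i mu (s i) == mu k)
        psi t `^ (- mu k) *: calG (fun i => Q (s i) t))); last first.
  apply: funext => t; rewrite big_seq_cond [RHS]big_seq_cond; apply: eq_bigl => m.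
  by rewrite mem_index_iota /=; case: (ltnP 1 m); rewrite ?andbT ?andbF.
apply: decays_sum => m m2; apply: decays_sum => s _.
exact: calG_product_decays.
Unshelve. all: by end_near. Qed.

(** The partial sum solves the equation up to a forcing of order mu (N + 1), so the
    stability estimate bounds its distance to y. *)
Lemma expansion_step : decays (mu N.+1) (fun t => y t - partial_sum N.+1 t).
Proof.
have [M [M2 muM]] : exists M, (2 <= M)%N /\ 2 * mu N.+1 <= M%:R * mu 0%N.
  (* The 2 compensates for the rate mu 0 / 2 used to bound the Taylor remainder. *)
  exists (Num.truncn (2 * mu N.+1 / mu 0%N)).+2; split=> //.
  rewrite -ler_pdivrMr //; apply: ltW.
  by apply: (lt_trans (truncnS_gt _)); rewrite ltr_nat.
have sum_slow : slow mstar (mu 0%N) (partial_sum N.+1).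
  apply: slow_sum => k; apply: (@slow_le _ _ _ (mu k)) => //.
  exact: mu_le.
have [_ [dsum [dsumE dsum_decays]]] := sum_slow.
move=> nu nu_lt; have [eps eps0 stable] := stable_decay mstar A_diag.
pose g t := (G (y t) - \sum_(k < N.+1) psi t `^ (- mu k) *:
      finite_rec_sum calG mu M N.+1 k (Q^~ t)) +
  (f t - \sum_(k < N.+1) psi t `^ (- mu k) *: P k t) - dsum t.
have [C C0 gC] : bigO_pow psi nu g.
  suff : decays (mu N.+1) g by exact.
  apply: decaysB => //; apply: decaysD => //.
  exact: nonlinearity_decays.
apply: (stable nu C _ g); last first.
  near=> t; rewrite ler_wpDl ?mulr_ge0 ?(ltW eps0) //.
  by near: t.
near=> t.
have dy : forall i, is_derive (t : R) 1 (fun s => y s i 0)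
  ((- (A *m y t) + G (y t) + f t) i 0) by near: t.
have ds : forall i, is_derive (t : R) 1 (fun s => partial_sum N.+1 s i 0)
  (dsum t i 0) by near: t.
move=> i.
rewrite (_ : (fun s => _) = (fun s => y s i 0) - (fun s => partial_sum N.+1 s i 0)).
  have -> : - (A *m (y t - partial_sum N.+1 t)) + g t =
    (- (A *m y t) + G (y t) + f t) - dsum t.
    have -> : A *m (y t - partial_sum N.+1 t) = A *m y t -
       (\sum_(k < N.+1) psi t `^ (- mu k) *:
          finite_rec_sum calG mu M N.+1 k (Q^~ t) +
        \sum_(k < N.+1) psi t `^ (- mu k) *: P k t).
      rewrite mulmxBr mulmx_sumr -big_split /=; congr (_ - _).
      apply: eq_bigr => k _; rewrite -scalemxAr (@Q_rec M N.+1) ?scalerDr //.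
        by rewrite ltnW.
      have := mu_le mu_incr (ltnW (ltn_ord k)); have := mu_gt0 N.+1.
      have := mu_gt0 0%N; rewrite -natr1 mulrDl mul1r; lra.
    rewrite /g; move: (\sum_(k < _) _) (\sum_(k < _) _) => s1 s2.
    by apply/matrixP => a b; rewrite !mxE; ring.
  have -> : (- (A *m y t) + G (y t) + f t - dsum t) i 0 =
      (- (A *m y t) + G (y t) + f t) i 0 - dsum t i 0.
    by rewrite [LHS]mxE [X in _ + X = _]mxE.
  exact: is_deriveB.
by apply: funext => s; rewrite !mxE.
Unshelve. all: by end_near. Qed.

End Step.

Lemma solution_expansion N : decays (mu N) (fun t => y t - partial_sum N t).
Proof.
elim: N => [|N IH]; last exact: expansion_step.
apply: (@decays_near _ _ _ _ _ y); last exact: y_decays.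
by near=> t; rewrite /partial_sum big_ord0 subr0.
Unshelve. all: by end_near. Qed.

End Expansion.

(** * The coefficients as generalized polynomials *)

Section Landau.
Variables (R : realType) (n m : nat).
Local Notation psi := (@iterlog R m).

Lemma bigO_pinfty_bigO_pow nu (g : R -> 'cV[R]_n) :
  bigO_pinfty g (fun t => psi t `^ (- nu)) <-> bigO_pow psi nu g.
Proof.
split=> [[T [C [T0 C0 gC]]]|[C C0 [M [_ gC]]]].
  exists C => //; near=> t; rewrite (le_trans (norm_le_enorm _)) //; apply: gC.
  by near: t; apply: nbhs_pinfty_ge; rewrite num_real.
have n1 : 0 < n.+1%:R :> R by rewrite ltr0n.
exists (`|M| + 1), (n.+1%:R * C); split.
- by rewrite ltr_wpDl.
- exact: mulr_gt0.
move=> t tM; apply: (@le_trans _ _ (n.+1%:R * `|g t|)).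
  by rewrite (le_trans (enorm_le_norm _)) // ler_wpM2r // ler_nat.
rewrite -mulrA ler_wpM2l // gC // (le_lt_trans (ler_norm M)) //.
by rewrite (lt_le_trans _ tM) // ltrDl.
Unshelve. all: by end_near. Qed.

End Landau.

Lemma diagonalizable_pos_unit (R : realType) n (A : 'M[R]_n) :
  diagonalizable_pos A -> A \in unitmx.
Proof.
move=> [S [d [Su d0 ->]]]; rewrite !unitmx_mul unitmx_inv Su andbT /=.
by rewrite unitmxE det_diag unitfE; apply/prodf_neq0 => i _; rewrite gt_eqF.
Qed.

Section Coefficients.
Variables (R : realType) (n : nat) (A : 'M[R]_n).
Variable calG : forall m, ('I_m -> 'cV[R]_n) -> 'cV[R]_n.
Hypothesis calG_multilinear : forall m, (2 <= m)%N -> multilinear (@calG m).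
Variable mu : nat -> R.
Hypothesis mu_gt0 : forall k, 0 < mu k.
Hypothesis mu_incr : forall i j, (i < j)%N -> mu i < mu j.
Variable nk : nat -> nat.
Hypothesis nk_incr : forall i j, (i <= j)%N -> (nk i <= nk j)%N.
Variable p : forall k, 'rV[R]_(nk k) -> 'cV[R]_n.
Arguments p : clear implicits.
Hypothesis p_genpoly : forall k, genpoly (p k).

Lemma firstcoords_id k (z : 'rV[R]_k) : firstcoords k z = z.
Proof.
apply/rowP => i; rewrite (firstcoordsE z (ltn_ord i)).
by congr (z 0 _); apply: val_inj.
Qed.

(** The value of q_k at a point z with sufficiently many coordinates. Keeping the
    number l of coordinates free makes the identification of polynomials in
    different numbers of variables a mere restriction of z. *)
Definition coefficient l (z : 'rV[R]_l) k : 'cV[R]_n :=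
  rec_solution A calG mu (fun j => p j (firstcoords (nk j) z)) k.

Lemma monom_sum_coefficient l k : (nk k <= l)%N ->
  monom_sum (fun z : 'rV[R]_l => coefficient z k).
Proof.
elim/ltn_ind: k => k IH kl; pose M := Num.truncn (mu k / mu 0%N).
have kM : mu k < M.+1%:R * mu 0%N by rewrite -ltr_pdivrMr // truncnS_gt.
apply: (@eq_monom_sum _ _ _ _ (fun z => invmx A *m
  (finite_rec_sum calG mu M k k (coefficient z) + p k (firstcoords (nk k) z)))).
  move=> z _; rewrite /coefficient rec_solutionE //.
  by rewrite (rec_stepE A calG mu_gt0 mu_incr _ _ (leqnn k) kM).
apply: (monom_sum_linear (mulmx (invmx A))).
apply: monom_sumD; last first.
  by apply: monom_sum_firstcoords => //; apply/genpoly_monom_sum.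
apply: (@eq_monom_sum _ _ _ _ (fun z => \sum_(m <- index_iota 2 M.+1 | (2 <= m)%N)
   \sum_(s : {ffun 'I_m -> 'I_k} | \sum_i mu (s i) == mu k)
       calG (fun i => coefficient z (s i)))).
  move=> z _; rewrite /finite_rec_sum big_seq_cond [RHS]big_seq_cond.
  apply: eq_bigl => m; rewrite mem_index_iota /=.
  by case: (ltnP 1 m); rewrite ?andbT ?andbF.
apply: monom_sum_sum => m m2; apply: monom_sum_sum => s _.
apply: (monom_sum_multilinear (p := fun i z => coefficient z (s i))).
  exact: calG_multilinear.
by move=> i; apply: IH => //; rewrite (leq_trans _ kl) // nk_incr // ltnW.
Qed.

Lemma coefficient_firstcoords l j k (z : 'rV[R]_l) : (j <= k)%N ->
  coefficient (firstcoords (nk k) z) j = coefficient z j.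
Proof.
move=> jk; apply: eq_rec_solution => // i ij; rewrite firstcoords_comp //.
by rewrite nk_incr // (leq_trans ij).
Qed.

Lemma coefficient_recursion :
  expansion_recursion A calG mu p (fun k z => coefficient z k).
Proof.
split=> [z _|k k1 z z0].
  (* With degrees at most 1, the sum over the degrees m >= 2 is empty. *)
  rewrite /coefficient rec_solutionE // (@rec_stepE _ _ _ _ _ _ _ 1 0) //.
    by rewrite /finite_rec_sum big_geq // add0r firstcoords_id.
  by rewrite ltr_pMl // ltr1n.
rewrite [LHS]/coefficient rec_solutionE //.
have -> : p k z = p k (firstcoords (nk k) z) by rewrite firstcoords_id.
apply: (eq_rec_step A calG mu_gt0 mu_incr
  (P := fun j => p j (firstcoords (nk j) z))
  (P' := fun j => p j (firstcoords (nk j) z))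
  (Q' := fun j => genpoly_embed (fun z' : 'rV_(nk j) => coefficient z' j) z)) => //.
by move=> j _; rewrite /genpoly_embed coefficient_firstcoords.
Qed.

End Coefficients.

Theorem theorem5p6 (R : realType) (n : nat) (n_gt0 : (0 < n)%N)
  (A : 'M[R]_n) (A_diag : diagonalizable_pos A)
  (G : 'cV[R]_n -> 'cV[R]_n) (G_lip : locally_lipschitz G)
  (Gm : nat -> 'cV[R]_n -> 'cV[R]_n)
  (Gm_homog : forall m, (2 <= m)%N -> homog_poly_map m (Gm m))
  (G_expansion : forall N, (2 <= N)%N -> exists2 delta : R, 0 < delta &
     bigO_zero (fun y => G y - \sum_(2 <= m < N.+1) Gm m y)
               (fun y => enorm y `^ (N%:R + delta)))
  (calG : forall m : nat, ('I_m -> 'cV[R]_n) -> 'cV[R]_n)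
  (calG_multilinear : forall m, (2 <= m)%N -> multilinear (calG m))
  (calG_diag : forall m, (2 <= m)%N -> forall y, Gm m y = calG m (fun _ => y))
  (mstar : nat) (mstar_gt0 : (0 < mstar)%N)
  (f : R -> 'cV[R]_n)
  (Tf : R) (Tf_ge0 : 0 <= Tf) (f_cont : {within `[Tf, +oo[, continuous f})
  (mu : nat -> R)
  (mu_gt0 : forall k, 0 < mu k)
  (mu_incr : forall i j, (i < j)%N -> mu i < mu j)
  (mu_div : mu k @[k --> \oo] --> +oo)
  (mu_add : forall x y, range mu x -> range mu y -> range mu (x + y))
  (nk : nat -> nat)
  (nk_gt0 : forall k, (0 < nk k)%N)
  (nk_incr : forall i j, (i <= j)%N -> (nk i <= nk j)%N)
  (p : forall k, 'rV[R]_(nk k) -> 'cV[R]_n)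
  (p_genpoly : forall k, genpoly (p k))
  (f_expansion : log_expansion mstar mu p f)
  (T0 : R) (T0_ge0 : 0 <= T0)
  (y : R -> 'cV[R]_n)
  (y_derivable : forall t, T0 < t -> derivable y t 1)
  (y_C1 : {within `]T0, +oo[, continuous (derive1 y)})
  (y_ode : forall t, T0 < t -> derive1 y t = - (A *m y t) + G (y t) + f t)
  (y_cvg0 : y t @[t --> +oo] --> (0 : 'cV[R]_n)) :
  exists q : forall k, 'rV[R]_(nk k) -> 'cV[R]_n,
    [/\ forall k, genpoly (q k),
        expansion_recursion A calG mu p q
      & log_expansion mstar mu q y].
Proof.
have iterlogs_coef k t : @coefficient R n A calG mu nk p _ (iterlogs mstar (nk k) t) k =
    rec_solution A calG mu (fun j => p j (iterlogs mstar (nk j) t)) k.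
  apply: (eq_rec_solution _ _ mu_gt0 mu_incr) => j jk.
  by rewrite firstcoords_iterlogs ?nk_incr.
exists (fun k z => coefficient A calG mu p z k); split.
- by move=> k; apply/genpoly_monom_sum; exact: monom_sum_coefficient.
- exact: coefficient_recursion.
have term_p k : slow mstar (mu k) (fun t =>
    iterlog mstar t `^ (- mu k) *: p k (iterlogs mstar (nk k) t)).
  by apply: slow_genpoly => //; exact/genpoly_monom_sum.
have y_deriv : \forall t \near +oo, forall i,
    is_derive (t : R) 1 (fun s => y s i 0) ((- (A *m y t) + G (y t) + f t) i 0).
  near=> t => i.
  have T0t : T0 < t by near: t; apply: nbhs_pinfty_gt; rewrite num_real.
  rewrite -y_ode // derive1E derive_mx; last exact: y_derivable.
  rewrite mxE; apply/derivableP.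
  by move: (y_derivable _ T0t) => /derivable_mxP.
have f_decays N : decays (iterlog mstar) (mu N) (fun t => f t -
    \sum_(k < N) iterlog mstar t `^ (- mu k) *: p k (iterlogs mstar (nk k) t)).
  have [nu muN /bigO_pinfty_bigO_pow fO] := f_expansion N.
  (* The bound after N terms comes from the one after N + 1 terms: the hypothesis at
     N controls the latter beyond mu N, and the term N has order mu N. *)
  apply: (@decays_near _ _ _ _ _ (fun t => (f t - \sum_(k < N.+1)
      iterlog mstar t `^ (- mu k) *: p k (iterlogs mstar (nk k) t)) +
      iterlog mstar t `^ (- mu N) *: p N (iterlogs mstar (nk N) t))).
    by near=> t; rewrite big_ord_recr /= opprD addrA subrK.
  apply: decaysD; last by have [] := term_p N.
  move=> nu' nu'N; apply: bigO_pow_le fO; first exact: iterlog_ge1.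
  by rewrite ltW // (lt_trans nu'N).
have A_unit := diagonalizable_pos_unit A_diag.
(* Decay at order mu (N + 1) yields every smaller exponent; the midpoint also
   exceeds mu N. *)
move=> N; exists ((mu N + mu N.+1) / 2).
  by have := mu_incr _ _ (ltnSn N); lra.
apply/bigO_pinfty_bigO_pow.
have y_expansion := @solution_expansion R n A A_diag G Gm G_expansion calG
  calG_multilinear calG_diag mstar mu mu_gt0 mu_incr mu_add
  (fun k t => p k (iterlogs mstar (nk k) t))
  (fun k t => rec_solution A calG mu (fun j => p j (iterlogs mstar (nk j) t)) k)
  _ _ f f_decays y y_deriv y_cvg0 N.+1.
rewrite (_ : (fun t => _) = fun t => y t - partial_sum mstar mu
    (fun k t => rec_solution A calG mu (fun j => p j (iterlogs mstar (nk j) t)) k)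
    N.+1 t).
  apply: y_expansion; last by have := mu_incr _ _ (ltnSn N); lra.
  - move=> k; apply: (@slow_near _ _ _ _ _ (fun t => iterlog mstar t `^ (- mu k) *:
        coefficient A calG mu p (iterlogs mstar (nk k) t) k)).
      by near=> t; rewrite iterlogs_coef.
    apply: (@slow_genpoly _ _ _ _ (mu k) (fun z => coefficient A calG mu p z k)) => //.
    exact: monom_sum_coefficient.
  - move=> M K k t kK kM; rewrite rec_solutionE //.
    by rewrite (rec_stepE A calG mu_gt0 mu_incr _ _ kK kM) mulKVmx.
apply: funext => t; congr (_ - _); apply: eq_bigr => k _.
by rewrite /term -iterlogs_coef.
Unshelve. all: by end_near. Qed.
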